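(* Let $f\in H^2(\mathbf T^2)$. For any integer $k_0\ge1$ and any previously fixed $a_1,b_1,\dots,a_{k_0-1},b_{k_0-1}$ in $\mathbf D$, if the parameter pairs $(a_{k_0},b_{k_0}),(a_{k_0+1},b_{k_0+1}),\dots$ are selected successively according to the Maximal Selection Principle, then $$\lim_{n\to\infty}\|f-S_n(f)\|^2=0;$$ in other words, $f=\lim_{n\to\infty}S_n(f)$ in the sense of $L^2$-convergence.
   Context: $\mathbf D$ is the open unit disc and $\mathbf T=\partial\mathbf D$. $L^2(\mathbf T^2)$ has inner product $\langle f,g\rangle=\frac1{4\pi^2}\int_{-\pi}^{\pi}\int_{-\pi}^{\pi}f(e^{it},e^{is})\overline{g(e^{it},e^{is})}\,dt\,ds$, and $H^2(\mathbf T^2)$ is the closed subspace of functions of the form $\sum_{k,l\ge0}c_{kl}e^{i(kt+ls)}$. For $\mathbf a=\{a_1,a_2,\dots\}$ in $\mathbf D$ (repetitions allowed), the Takenaka-Malmquist functions are $B^{\mathbf a}_k(z)=\frac{\sqrt{1-|a_k|^2}}{1-\overline{a}_kz}\prod_{l=1}^{k-1}\frac{z-a_l}{1-\overline{a}_lz}$; $B^{\mathbf b}_l$ is defined similarly from $\mathbf b=\{b_1,b_2,\dots\}$, and $(B^{\mathbf a}_k\otimes B^{\mathbf b}_l)(z,w)=B^{\mathbf a}_k(z)B^{\mathbf b}_l(w)$. Set $S_n(f)=\sum_{1\le k,l\le n}\langle f,B^{\mathbf a}_k\otimes B^{\mathbf b}_l\rangle B^{\mathbf a}_k\otimes B^{\mathbf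 b}_l$, $S_0(f)=0$, and $D_n(f)=S_n(f)-S_{n-1}(f)$. The pair $(a_n,b_n)\in\mathbf D^2$ is selected according to the Maximal Selection Principle if, with $a_1,\dots,a_{n-1}$ and $b_1,\dots,b_{n-1}$ already fixed, the quantity $\|D_n(f)\|^2=\sum_{\max\{k,l\}=n}|\langle f,B^{\mathbf a}_k\otimes B^{\mathbf b}_l\rangle|^2$ attains at $(a_n,b_n)$ its maximal value among all possible choices of the $n$-th pair of parameters in $\mathbf D^2$. *)

(* Defs.v *)
From mathcomp Require Import all_boot all_order all_algebra.
From mathcomp Require Import complex.
From mathcomp Require Import all_classical all_reals all_analysis.

Set Implicit Arguments.
Unset Strict Implicit.
Unset Printing Implicit Defensive.

Import Order.TTheory GRing.Theory Num.Theory.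
Import numFieldNormedType.Exports.

Local Open Scope classical_set_scope.
Local Open Scope ring_scope.
Local Open Scope complex_scope.

Section HardySpaceTorus.
Variable R : realType.
Implicit Types (f g : R[i] -> R[i] -> R[i]) (a b : nat -> R[i]).

Definition unit_disc : set R[i] := [set z : R[i] | Normc.normc z < 1].

Definition expi (t : R) : R[i] := cos t +i* sin t.

(* A function on T^2 is represented by any total function on C^2 extending it;
   only its values at the points (e^{it}, e^{is}) matter. *)
Definition on_torus f (x : R * R) : R[i] := f (expi x.1) (expi x.2).

Definition square : set (measurableTypeR R * measurableTypeR R) :=
  `[- pi, pi] `*` `[- pi, pi].

Definition lebesgue2 :
    {measure set (measurableTypeR R * measurableTypeR R) -> \bar R} :=
  (@lebesgue_measure R \x @lebesgue_measure R)%E.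

(* ||f||^2, as an extended real, so that no finiteness convention is needed *)
Definition sqnorm f : \bar R :=
  (((4 * pi ^+ 2)^-1)%:E *
   \int[lebesgue2]_(x in square)
      (Normc.normc (on_torus f x) ^+ 2)%:E)%E.

Definition L2 f : Prop :=
  [/\ measurable_fun square (fun x => complex.Re (on_torus f x)),
      measurable_fun square (fun x => complex.Im (on_torus f x)) &
      (sqnorm f < +oo)%E].

Definition complex_integral (h : R * R -> R[i]) : R[i] :=
  Rintegral lebesgue2 square (fun x => complex.Re (h x)) +i*
  Rintegral lebesgue2 square (fun x => complex.Im (h x)).

Definition inner f g : R[i] :=
  ((4 * pi ^+ 2)^-1)%:C *
  complex_integral (fun x => on_torus f x * (on_torus g x)^*%C).

(* On T^2, z ^+ k * w ^+ l is e^{i(kt+ls)}; the double series is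
   understood in the sense of L^2-convergence. *)
Definition H2 f : Prop :=
  L2 f /\ exists c : nat -> nat -> R[i],
    sqnorm (fun z w => f z w -
              \sum_(0 <= k < N) \sum_(0 <= l < N) c k l * (z ^+ k * w ^+ l))
      @[N --> \oo] --> 0%E.

(* Takenaka-Malmquist functions; as for the parameters, the index k starts
   at 1, and a 0 plays no role. *)
Definition TM a (k : nat) (z : R[i]) : R[i] :=
  (Num.sqrt (1 - Normc.normc (a k) ^+ 2))%:C / (1 - (a k)^*%C * z) *
  \prod_(1 <= l < k) ((z - a l) / (1 - (a l)^*%C * z)).

Definition tensor (u v : R[i] -> R[i]) : R[i] -> R[i] -> R[i] :=
  fun z w => u z * v w.

Definition S_ a b f (n : nat) : R[i] -> R[i] -> R[i] := fun z w =>
  \sum_(1 <= k < n.+1) \sum_(1 <= l < n.+1)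
    inner f (tensor (TM a k) (TM b l)) * tensor (TM a k) (TM b l) z w.

Definition D_ a b f (n : nat) : R[i] -> R[i] -> R[i] := fun z w =>
  S_ a b f n z w - S_ a b f n.-1 z w.

(* D_ a b f n depends only on the parameters of index 1, ..., n, so varying
   the n-th pair is the same as updating both sequences at n. *)
Definition max_selection a b f (n : nat) : Prop :=
  [/\ unit_disc (a n), unit_disc (b n) &
   forall alpha beta, unit_disc alpha -> unit_disc beta ->
     (sqnorm (D_ [eta a with n |-> alpha] [eta b with n |-> beta] f n)
        <= sqnorm (D_ a b f n))%E].

End HardySpaceTorus.

(* Main.v *)
Require Import Defs.
From mathcomp Require Import all_boot all_order all_algebra.
From mathcomp Require Import complex.
From mathcomp Require Import ring lra.
From mathcomp Require Import all_classical all_reals all_analysis.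
From mathcomp Require Import measurable_realfun.

(** Let r_n = f - S_n(f) be the residual, S_n being the orthogonal projection
onto the span of the first n^2 tensor products of Takenaka-Malmquist functions.

The energy |r_n|^2 is decreasing and |D_n(f)|^2 = |r_(n-1)|^2 - |r_n|^2, so
|D_n(f)| tends to 0 for any parameters in the disc. Now fix (c, d) in the bidisc,
and let e_c(z) = 1 / (1 - conj(c) z) be the Szegő kernel. If (c, d) were chosen
as the n-th pair of parameters, then e_c (x) e_d would belong to the span onto
which the n-th sum projects: this is the Christoffel-Darboux formula
[szego_in_span_TM], evaluated at the last parameter. Hence <r_(n-1), e_c (x) e_d>
would be equal to <D'_n, e_c (x) e_d>, where D'_n is the increment produced by
(c, d), and by Cauchy-Schwarz and the Maximal Selection Principle
|<r_(n-1), e_c (x) e_d>| <= |D'_n| |e_c (x) e_d| <= |D_n(f)| |e_c (x) e_d|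
([residual_szego_le], [selection_bound]). So r_n tends to 0 weakly against every
e_c (x) e_d.

The sequence r_n being bounded, the functions against which it tends weakly to 0
are stable under linear combinations and limits in norm. The closed span of the
e_c contains every power of z: by induction on k it contains all
z^k / (1 - conj(c) z) ([szego_generates_Xn_szego]). Applying this to each
variable in turn, r_n tends weakly to 0 against every z^k w^l, and then against
every element of H^2, in particular f ([weakly_null_H2]). Since r_n is
orthogonal to S_n(f), |r_n|^2 = <r_n, f>, which tends to 0 ([residual_cvg0]).

Orthonormality of the system is proved without complex analysis. A bounded
function on the circle is said to be in H^oo when its Fourier coefficients of
negative index vanish; this class is stable under multiplication by Blaschke
factors ([Hinf_sub], [Hinf_szego]), and for k < l the product of B_l with the
conjugate of B_k is z times an element of that class ([TM_orthogonal]). Fubini's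
theorem then gives the two-variable statement ([TM_tensor_orthonormal]). *)

Set Implicit Arguments.
Unset Strict Implicit.
Unset Printing Implicit Defensive.

Import Order.TTheory GRing.Theory Num.Theory.
Import numFieldNormedType.Exports.

Local Open Scope classical_set_scope.
Local Open Scope ring_scope.
Local Open Scope complex_scope.

Local Notation Re := complex.Re.
Local Notation Im := complex.Im.
Local Notation normc := Normc.normc.

(** * Complex numbers and complex-valued integrals *)

Section ComplexNumbers.
Variable R : realType.
Implicit Types (x y z : R[i]).

Lemma ReD x y : Re (x + y) = Re x + Re y. Proof. by case: x y => ? ? []. Qed.
Lemma ImD x y : Im (x + y) = Im x + Im y. Proof. by case: x y => ? ? []. Qed.
Lemma ReN x : Re (- x) = - Re x. Proof. by case: x. Qed.
Lemma ReM x y : Re (x * y) = Re x * Re y - Im x * Im y.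
Proof. by case: x y => ? ? []. Qed.
Lemma ImM x y : Im (x * y) = Re x * Im y + Im x * Re y.
Proof. by case: x y => ? ? []. Qed.
Lemma ReJ x : Re x^*%C = Re x. Proof. by case: x. Qed.
Lemma ImJ x : Im x^*%C = - Im x. Proof. by case: x. Qed.

Lemma eqcP x y : Re x = Re y -> Im x = Im y -> x = y.
Proof. by case: x y => ? ? [? ?] /= -> ->. Qed.

Lemma conjcM x y : (x * y)^*%C = x^*%C * y^*%C.
Proof. exact: (rmorphM (@conjc R)). Qed.

Lemma conjcD x y : (x + y)^*%C = x^*%C + y^*%C.
Proof. exact: (rmorphD (@conjc R)). Qed.

Lemma conjcB x y : (x - y)^*%C = x^*%C - y^*%C.
Proof. exact: (rmorphB (@conjc R)). Qed.

Lemma real_complexM (r s : R) : (r * s)%:C = r%:C * s%:C :> R[i].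
Proof. exact: (rmorphM (real_complex R)). Qed.

Lemma real_complexB (r s : R) : (r - s)%:C = r%:C - s%:C :> R[i].
Proof. exact: (rmorphB (real_complex R)). Qed.

Lemma normcE2 x : normc x ^+ 2 = Re x ^+ 2 + Im x ^+ 2.
Proof. by case: x => a b /=; rewrite sqr_sqrtr// addr_ge0 ?sqr_ge0. Qed.

Lemma normc_ge0 x : 0 <= normc x.
Proof. by case: x => a b; apply: sqrtr_ge0. Qed.

Lemma normcJ2 x : normc x^*%C = normc x.
Proof. by case: x => a b /=; rewrite sqrrN. Qed.

Lemma normcX x n : normc (x ^+ n) = normc x ^+ n.
Proof.
elim: n => [|n IH]; first by rewrite !expr0 Normc.normc1.
by rewrite !exprS Normc.normcM IH.
Qed.

Lemma normcR (r : R) : normc r%:C = `|r|.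
Proof. by rewrite /= expr0n addr0 sqrtr_sqr. Qed.

Lemma normc_eq0 x : (normc x == 0) = (x == 0).
Proof. by apply/eqP/eqP => [/Normc.eq0_normc//|->]; rewrite Normc.normc0. Qed.

Lemma mulcJ x : x * x^*%C = (normc x ^+ 2)%:C.
Proof. by apply: eqcP; rewrite ?ReM ?ImM ReJ ImJ ?normcE2 /=; ring. Qed.

Lemma invcE x : x^-1 = x^*%C * ((normc x ^+ 2)^-1)%:C.
Proof.
rewrite normcE2; apply: eqcP; rewrite ?ReM ?ImM ReJ ImJ /= !mulr0 ?subr0 ?add0r.
  by case: x.
by case: x => a b /=; rewrite mulNr.
Qed.

Lemma Re_le_normc x : `|Re x| <= normc x.
Proof.
rewrite -(@ler_pXn2r _ 2)// ?nnegrE ?normr_ge0 ?normc_ge0//.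
by rewrite real_normK ?num_real// normcE2 lerDl sqr_ge0.
Qed.

Lemma Im_le_normc x : `|Im x| <= normc x.
Proof.
rewrite -(@ler_pXn2r _ 2)// ?nnegrE ?normr_ge0 ?normc_ge0//.
by rewrite real_normK ?num_real// normcE2 lerDr sqr_ge0.
Qed.

Lemma normc_le_ReIm x : normc x <= `|Re x| + `|Im x|.
Proof.
rewrite -(@ler_pXn2r _ 2)// ?nnegrE ?addr_ge0 ?normr_ge0 ?normc_ge0//.
rewrite normcE2 sqrrD !real_normK ?num_real//.
have := mulr_ge0 (normr_ge0 (Re x)) (normr_ge0 (Im x)); lra.
Qed.

Lemma normcB_ge x y : normc x - normc y <= normc (x - y).
Proof. by rewrite lerBlDr -{1}(subrK y x) le_normcD. Qed.

Lemma normc_expi (t : R) : normc (expi t) = 1.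
Proof. by rewrite /= cos2Dsin2 sqrtr1. Qed.

End ComplexNumbers.

Section ComplexMeasurable.
Context d (T : measurableType d) (R : realType) (D : set T).
Implicit Types (f g : T -> R[i]).

(** Complex-valued functions are handled through their real and imaginary
parts, which is the form in which square-integrability on the torus is stated.
*)
Definition cmeasurable f :=
  measurable_fun D (fun x => Re (f x)) /\ measurable_fun D (fun x => Im (f x)).

Lemma cmeasurable_cst c : cmeasurable (fun=> c).
Proof. by split; apply: measurable_cst. Qed.

Lemma cmeasurableD f g :
  cmeasurable f -> cmeasurable g -> cmeasurable (fun x => f x + g x).
Proof.
move=> [f1 f2] [g1 g2]; split.
  by under eq_fun do rewrite ReD; exact: measurable_funD.
by under eq_fun do rewrite ImD; exact: measurable_funD.
Qed.

Lemma cmeasurableM f g :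
  cmeasurable f -> cmeasurable g -> cmeasurable (fun x => f x * g x).
Proof.
move=> [f1 f2] [g1 g2]; split.
  under eq_fun do rewrite ReM.
  by apply: measurable_funB; exact: measurable_funM.
under eq_fun do rewrite ImM.
by apply: measurable_funD; exact: measurable_funM.
Qed.

Lemma cmeasurableJ f : cmeasurable f -> cmeasurable (fun x => (f x)^*%C).
Proof.
move=> [f1 f2]; split; first by under eq_fun do rewrite ReJ.
by under eq_fun do rewrite ImJ; exact: measurable_funN.
Qed.

Lemma cmeasurable_normc2 f :
  cmeasurable f -> measurable_fun D (fun x => normc (f x) ^+ 2).
Proof.
move=> [f1 f2]; under eq_fun do rewrite normcE2.
by apply: measurable_funD; exact: measurable_funX.
Qed.

(** Writing the inverse as the conjugate times the power -1 of the squared norm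
avoids a case distinction at 0, since the real power function is measurable on
the whole line. *)
Lemma cmeasurableV f : cmeasurable f -> cmeasurable (fun x => (f x)^-1).
Proof.
move=> mf.
have -> : (fun x => (f x)^-1) =
    (fun x => (f x)^*%C * ((normc (f x) ^+ 2) `^ (-1))%:C).
  by apply/funext => x; rewrite powR_inv1 ?sqr_ge0// invcE.
apply: cmeasurableM; first exact: cmeasurableJ.
split => /=; last exact: measurable_cst.
by apply: (measurableT_comp (measurable_powR _)); exact: cmeasurable_normc2.
Qed.

End ComplexMeasurable.

Section ComplexIntegral.
Context d (T : measurableType d) (R : realType).
Variables (mu : {measure set T -> \bar R}) (D : set T).
Hypothesis mD : measurable D.
Implicit Types (f g : T -> R[i]).

Definition cintegrable f :=
  mu.-integrable D (fun x => (Re (f x))%:E) /\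
  mu.-integrable D (fun x => (Im (f x))%:E).

Definition cintegral f : R[i] :=
  Rintegral mu D (fun x => Re (f x)) +i* Rintegral mu D (fun x => Im (f x)).

Lemma eq_cintegral f g : {in D, f =1 g} -> cintegral f = cintegral g.
Proof.
by move=> fg; congr (_ +i* _); apply: eq_Rintegral => x xD; rewrite fg.
Qed.

Lemma cintegralD f g : cintegrable f -> cintegrable g ->
  cintegral (fun x => f x + g x) = cintegral f + cintegral g.
Proof.
move=> [f1 f2] [g1 g2]; rewrite /cintegral.
under eq_Rintegral do rewrite ReD.
under [X in _ +i* X = _]eq_Rintegral do rewrite ImD.
by rewrite !RintegralD.
Qed.

Lemma cintegralZ c f : cintegrable f ->
  cintegral (fun x => c * f x) = c * cintegral f.
Proof.
move=> [f1 f2]; rewrite /cintegral.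
under eq_Rintegral do rewrite ReM.
under [X in _ +i* X = _]eq_Rintegral do rewrite ImM.
have iZ (r : R) (g : T -> R) : mu.-integrable D (EFin \o g) ->
    mu.-integrable D (EFin \o (fun x => r * g x)).
  move=> ig; rewrite /comp; under eq_fun do rewrite EFinM.
  exact: integrableZl.
rewrite RintegralB ?RintegralD//; [|exact: iZ..].
by rewrite !RintegralZl//; apply: eqcP; rewrite ?ReM ?ImM.
Qed.

Lemma cintegralJ f : cintegrable f ->
  cintegral (fun x => (f x)^*%C) = (cintegral f)^*%C.
Proof.
move=> [f1 f2]; rewrite /cintegral.
under eq_Rintegral do rewrite ReJ.
under [X in _ +i* X = _]eq_Rintegral do rewrite ImJ -mulN1r.
by rewrite RintegralZl// mulN1r.
Qed.

Hypothesis muD : (mu D < +oo)%E.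

Lemma cintegrable_bounded f (M : R) : cmeasurable D f ->
  (forall x, D x -> normc (f x) <= M) -> cintegrable f.
Proof.
move=> [f1 f2] fM; split; apply: measurable_bounded_integrable => //.
  exists M; split; first by rewrite num_real.
  move=> y My x Dx; apply: le_trans (ltW My).
  exact: le_trans (Re_le_normc _) (fM _ Dx).
exists M; split; first by rewrite num_real.
move=> y My x Dx; apply: le_trans (ltW My).
exact: le_trans (Im_le_normc _) (fM _ Dx).
Qed.

(** The factor 2 comes from bounding the real and imaginary parts separately;
only the order of magnitude matters in the sequel. *)
Lemma normc_cintegral_le f (M : R) : cmeasurable D f ->
  (forall x, D x -> normc (f x) <= M) ->
  normc (cintegral f) <= 2 * (M * fine (mu D)).
Proof.
move=> mf fM; have [i1 i2] := cintegrable_bounded mf fM.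
have icst : mu.-integrable D (EFin \o cst M).
  by apply: measurable_bounded_integrable => //; exact: bounded_cst.
apply: (le_trans (normc_le_ReIm _)).
rewrite mulr2n mulrDl !mul1r -(Rintegral_cst _ mD); apply: lerD => /=.
  apply: (le_trans (le_normr_Rintegral mD i1)).
  apply: le_Rintegral => // [|x Dx]; first exact: integrable_norm.
  exact: le_trans (Re_le_normc _) (fM _ Dx).
apply: (le_trans (le_normr_Rintegral mD i2)).
apply: le_Rintegral => // [|x Dx]; first exact: integrable_norm.
exact: le_trans (Im_le_normc _) (fM _ Dx).
Qed.

End ComplexIntegral.

(** * Square-integrable functions on the torus *)

Section TorusL2.
Variable R : realType.
Implicit Types (f g h : R[i] -> R[i] -> R[i]).

Local Notation mu := (@lebesgue2 R).
Local Notation sq := (@square R).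

Lemma pi2_gt0 : 0 < 4 * pi ^+ 2 :> R.
Proof. by rewrite mulr_gt0// exprn_gt0// pi_gt0. Qed.

Lemma measurable_square : measurable sq.
Proof. by apply: measurableX; exact: measurable_itv. Qed.
Local Notation msq := measurable_square.

Lemma lebesgue_measure_period :
  @lebesgue_measure R `[- pi, pi] = (2 * pi)%:E.
Proof.
rewrite lebesgue_measure_itv/= lte_fin gtrN ?pi_gt0// -EFinB.
by congr (_%:E); ring.
Qed.

Lemma lebesgue2_square : mu sq = (4 * pi ^+ 2)%:E.
Proof.
rewrite /lebesgue2 /square/= product_measure1E; [|exact: measurable_itv..].
rewrite /= !lebesgue_measure_period -EFinM; congr (_%:E); ring.
Qed.

Lemma lebesgue2_square_lty : (mu sq < +oo)%E.
Proof. by rewrite lebesgue2_square ltry. Qed.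

Lemma L2P f : L2 f <-> cmeasurable sq (on_torus f) /\
  mu.-integrable sq (fun x => (normc (on_torus f x) ^+ 2)%:E).
Proof.
have nneg x : (0%E <= (normc (on_torus f x) ^+ 2)%:E)%E.
  by rewrite lee_fin sqr_ge0.
split=> [[m1 m2 fin]|[[m1 m2] /integrableP[_ fin]]].
  split=> //; apply/integrableP; split.
    by apply/measurable_EFinP; apply: cmeasurable_normc2.
  under eq_integral do rewrite gee0_abs//.
  move: fin; rewrite /sqnorm; apply: contraTT.
  rewrite -leNgt leye_eq => /eqP ->.
  by rewrite gt0_muley ?ltxx// lte_fin invr_gt0 pi2_gt0.
split=> //; rewrite /sqnorm lte_mul_pinfty// ?lee_fin ?invr_ge0 ?ltW ?pi2_gt0//.
by under eq_integral do rewrite -(gee0_abs (nneg _)).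
Qed.

Lemma L2_bounded f (M : R) : cmeasurable sq (on_torus f) ->
  (forall t s, normc (f (expi t) (expi s)) <= M) -> L2 f.
Proof.
move=> mf fM; apply/L2P; split=> //.
have mff : cmeasurable sq (fun x => on_torus f x * (on_torus f x)^*%C).
  by apply: cmeasurableM => //; exact: cmeasurableJ.
have bff x : sq x -> normc (on_torus f x * (on_torus f x)^*%C) <= M ^+ 2.
  move=> _; rewrite Normc.normcM normcJ2 -expr2 lerXn2r ?nnegrE ?normc_ge0//.
    exact: le_trans (normc_ge0 _) (fM x.1 x.2).
  exact: fM.
have [+ _] := cintegrable_bounded msq lebesgue2_square_lty mff bff.
by under eq_fun do rewrite mulcJ.
Qed.

(** Domination by |f|^2 + |g|^2. *)
Lemma L2_mulJ f g : L2 f -> L2 g ->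
  cintegrable mu sq (fun x => on_torus f x * (on_torus g x)^*%C).
Proof.
move=> /L2P[mf if_] /L2P[mg ig].
have [m1 m2] : cmeasurable sq (fun x => on_torus f x * (on_torus g x)^*%C).
  by apply: cmeasurableM => //; exact: cmeasurableJ.
have iS := integrableD msq if_ ig.
have le x : normc (on_torus f x * (on_torus g x)^*%C) <=
    normc (on_torus f x) ^+ 2 + normc (on_torus g x) ^+ 2.
  rewrite Normc.normcM normcJ2.
  have := sqr_ge0 (normc (on_torus f x) - normc (on_torus g x)).
  have := mulr_ge0 (normc_ge0 (on_torus f x)) (normc_ge0 (on_torus g x)).
  by rewrite sqrrB; lra.
have ge0 x : 0 <= normc (on_torus f x) ^+ 2 + normc (on_torus g x) ^+ 2.
  by rewrite addr_ge0// sqr_ge0.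
split; apply: (le_integrable msq _ _ iS) => [|x _].
- exact/measurable_EFinP.
- rewrite -EFinD /= lee_fin (ger0_norm (ge0 x)).
  exact: le_trans (Re_le_normc _) (le x).
- exact/measurable_EFinP.
- rewrite -EFinD /= lee_fin (ger0_norm (ge0 x)).
  exact: le_trans (Im_le_normc _) (le x).
Qed.

Lemma L2D f g : L2 f -> L2 g -> L2 (fun z w => f z w + g z w).
Proof.
move=> /L2P[mf if_] /L2P[mg ig]; apply/L2P.
have mfg : cmeasurable sq (on_torus (fun z w => f z w + g z w)).
  exact: cmeasurableD.
split=> //.
have iS := integrableZl msq 2 (integrableD msq if_ ig).
apply: (le_integrable msq _ _ iS) => [|x _].
  by apply/measurable_EFinP; exact: cmeasurable_normc2.
rewrite -EFinD -EFinM /= lee_fin ger0_norm ?sqr_ge0// ger0_norm; last first.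
  by rewrite mulr_ge0// addr_ge0// sqr_ge0.
rewrite {1}/on_torus -/(on_torus f x) -/(on_torus g x).
apply: (@le_trans _ _ ((normc (on_torus f x) + normc (on_torus g x)) ^+ 2)).
  by rewrite lerXn2r ?nnegrE ?addr_ge0 ?normc_ge0// le_normcD.
have := sqr_ge0 (normc (on_torus f x) - normc (on_torus g x)).
by rewrite sqrrB sqrrD; lra.
Qed.

Lemma L2Z c f : L2 f -> L2 (fun z w => c * f z w).
Proof.
move=> /L2P[mf if_]; apply/L2P; split.
  by apply: cmeasurableM => //; exact: cmeasurable_cst.
have iZ := integrableZl msq (normc c ^+ 2) if_.
under eq_fun do rewrite {1}/on_torus Normc.normcM exprMn EFinM.
exact: iZ.
Qed.

Lemma innerD f g h : L2 f -> L2 g -> L2 h ->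
  inner (fun z w => f z w + g z w) h = inner f h + inner g h.
Proof.
move=> Lf Lg Lh; rewrite /inner -mulrDr; congr (_ * _).
rewrite -[complex_integral _]/(cintegral mu sq _).
rewrite -(cintegralD msq (L2_mulJ Lf Lh) (L2_mulJ Lg Lh)).
by apply: eq_cintegral => x _; rewrite -mulrDl.
Qed.

Lemma innerZ c f h : L2 f -> L2 h ->
  inner (fun z w => c * f z w) h = c * inner f h.
Proof.
move=> Lf Lh; rewrite /inner [RHS]mulrCA; congr (_ * _).
rewrite -[complex_integral _]/(cintegral mu sq _).
rewrite -(cintegralZ msq c (L2_mulJ Lf Lh)).
by apply: eq_cintegral => x _; rewrite mulrA.
Qed.

Lemma innerJ f g : L2 f -> L2 g -> inner f g = (inner g f)^*%C.
Proof.
move=> Lf Lg; rewrite /inner conjcM conjc_real; congr (_ * _).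
rewrite -[complex_integral _]/(cintegral mu sq _).
rewrite -[complex_integral _]/(cintegral mu sq _).
rewrite -(cintegralJ msq (L2_mulJ Lg Lf)).
by apply: eq_cintegral => x _; rewrite conjcM conjcK mulrC.
Qed.

Lemma inner_self f : L2 f ->
  inner f f = (fine (sqnorm f))%:C /\ sqnorm f \is a fin_num.
Proof.
move=> /L2P[mf if_].
have fin := integrable_fin_num msq if_.
split; last by rewrite /sqnorm fin_numM.
rewrite /sqnorm fineM// /inner rmorphM; congr (_ * _).
apply: eqcP => /=.
  by congr fine; apply: eq_integral => x _; rewrite mulcJ.
under eq_Rintegral do rewrite mulcJ.
by rewrite Rintegral_cst ?mul0r//; exact: msq.
Qed.

Lemma sqnorm_ge0 f : (0 <= sqnorm f)%E.
Proof.
apply: mule_ge0; first by rewrite lee_fin invr_ge0 ltW// pi2_gt0.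
by apply: integral_ge0 => x _; rewrite lee_fin sqr_ge0.
Qed.

Lemma inner_ge0 f : L2 f -> 0 <= inner f f.
Proof. by move=> /inner_self[-> _]; rewrite ler0c fine_ge0// sqnorm_ge0. Qed.

Lemma sqnorm_bounded f (M : R) : cmeasurable sq (on_torus f) ->
  (forall t s, normc (f (expi t) (expi s)) <= M) ->
  (sqnorm f <= (M ^+ 2)%:E)%E.
Proof.
move=> mf fM; have /L2P[_ if_] := L2_bounded mf fM.
have -> : (M ^+ 2)%:E =
    (((4 * pi ^+ 2)^-1)%:E * \int[mu]_(x in sq) (M ^+ 2)%:E)%E.
  rewrite integral_cst; last exact: msq.
  rewrite [X in (_ * (_ * X))%E]lebesgue2_square -!EFinM; congr (_%:E).
  by rewrite mulrCA mulVf ?mulr1// gt_eqF// pi2_gt0.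
apply: lee_wpmul2l; first by rewrite lee_fin invr_ge0 ltW// pi2_gt0.
apply: le_integral => //; first exact: msq.
  apply: measurable_bounded_integrable => //; first exact: msq.
    exact: lebesgue2_square_lty.
  exact: bounded_cst.
move=> x _; rewrite lee_fin lerXn2r ?nnegrE ?normc_ge0//.
  exact: le_trans (normc_ge0 _) (fM x.1 x.2).
exact: fM.
Qed.

End TorusL2.

(** * Means of functions on the circle *)

Section Circle.
Variable R : realType.
Implicit Types (u v : R[i] -> R[i]) (a c : R[i]).

Local Notation leb := (@lebesgue_measure R).
Local Notation D := (`[- pi, pi]%classic : set (measurableTypeR R)).

Let mD : measurable D. Proof. exact: measurable_itv. Qed.

(** Bounded and measurable on the unit circle: the one-variable functions whose
tensor products lie in L^2 of the torus. *)
Definition bmcircle u :=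
  cmeasurable [set: measurableTypeR R] (u \o expi (R := R)) /\
  exists M : R, forall t, normc (u (expi t)) <= M.

Lemma bmcircle_cst c : bmcircle (fun=> c).
Proof. by split; [exact: cmeasurable_cst|exists (normc c)]. Qed.

Lemma bmcircle_id : bmcircle id.
Proof.
split; last by exists 1 => t; rewrite normc_expi.
split => /=; first by apply: continuous_measurable_fun; exact: continuous_cos.
by apply: continuous_measurable_fun; exact: continuous_sin.
Qed.

Lemma bmcircleD u v : bmcircle u -> bmcircle v -> bmcircle (fun z => u z + v z).
Proof.
move=> [mu [M uM]] [mv [N vN]]; split; first exact: cmeasurableD.
by exists (M + N) => t; apply: (le_trans (le_normcD _ _)); rewrite lerD.
Qed.

Lemma bmcircleM u v : bmcircle u -> bmcircle v -> bmcircle (fun z => u z * v z).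
Proof.
move=> [mu [M uM]] [mv [N vN]]; split; first exact: cmeasurableM.
by exists (M * N) => t; rewrite Normc.normcM ler_pM// normc_ge0.
Qed.

Lemma bmcircleJ u : bmcircle u -> bmcircle (fun z => (u z)^*%C).
Proof.
move=> [mu [M uM]]; split; first exact: cmeasurableJ.
by exists M => t; rewrite normcJ2.
Qed.

Lemma bmcircleX u k : bmcircle u -> bmcircle (fun z => u z ^+ k).
Proof.
move=> bu; elim: k => [|k IH]; first exact: bmcircle_cst.
have -> : (fun z => u z ^+ k.+1) = (fun z => u z * u z ^+ k).
  by apply/funext => z; rewrite exprS.
exact: bmcircleM.
Qed.

(** This keeps the pole 1 / conj(a) of the Szegő kernel at a away from the
closed unit disc. *)
Lemma szego_denom_ge a z : normc z <= 1 -> 1 - normc a <= normc (1 - a^*%C * z).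
Proof.
move=> z1; apply: le_trans (normcB_ge _ _).
rewrite Normc.normcM normcJ2 Normc.normc1 lerD2l lerN2.
by rewrite ler_piMr// normc_ge0.
Qed.

Lemma szego_denom_neq0 a z : unit_disc a -> normc z <= 1 -> 1 - a^*%C * z != 0.
Proof.
move=> a1 z1; rewrite -normc_eq0 gt_eqF//.
by apply: lt_le_trans (szego_denom_ge a z1); rewrite subr_gt0.
Qed.

Lemma normc_expi_le1 t : normc (expi t : R[i]) <= 1.
Proof. by rewrite normc_expi. Qed.
#[local] Hint Resolve normc_expi_le1 : core.

Lemma bmcircle_szego a : unit_disc a -> bmcircle (fun z => (1 - a^*%C * z)^-1).
Proof.
move=> a1; split.
  apply: (@cmeasurableV _ _ _ _ (fun t => 1 - a^*%C * expi t)).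
  have [] // : bmcircle (fun z => 1 - a^*%C * z).
  apply: bmcircleD; first exact: bmcircle_cst.
  under eq_fun do rewrite -mulNr.
  by apply: bmcircleM; [exact: bmcircle_cst|exact: bmcircle_id].
exists (1 - normc a)^-1 => t; rewrite Normc.normcV lef_pV2 ?szego_denom_ge//.
  rewrite posrE; apply: lt_le_trans (szego_denom_ge a (normc_expi_le1 t)).
  by rewrite subr_gt0.
by rewrite posrE subr_gt0.
Qed.

Lemma bmcircle_sub a : bmcircle (fun z => z - a).
Proof. by apply: bmcircleD; [exact: bmcircle_id|exact: bmcircle_cst]. Qed.

Lemma lebesgue_period_lty : (leb D < +oo)%E.
Proof. by rewrite lebesgue_measure_period ltry. Qed.

Lemma bmcircle_measurable u : bmcircle u -> cmeasurable D (fun t => u (expi t)).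
Proof. by move=> [[m1 m2] _]; split; exact: measurable_funTS. Qed.

Lemma bmcircle_integrable u : bmcircle u ->
  cintegrable leb D (fun t => u (expi t)).
Proof.
move=> bu; have [M uM] := bu.2.
apply: (cintegrable_bounded mD lebesgue_period_lty (bmcircle_measurable bu)).
by move=> t _; exact: uM.
Qed.

Definition mean u : R[i] :=
  ((2 * pi)^-1)%:C * cintegral leb D (fun t => u (expi t)).

Lemma eq_mean u v : (forall t, u (expi t) = v (expi t)) -> mean u = mean v.
Proof. by move=> uv; congr (_ * _); apply: eq_cintegral => t _; rewrite uv. Qed.

Lemma meanD u v : bmcircle u -> bmcircle v ->
  mean (fun z => u z + v z) = mean u + mean v.
Proof.
by move=> bu bv; rewrite /mean cintegralD ?mulrDr//; exact: bmcircle_integrable.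
Qed.

Lemma meanZ c u : bmcircle u -> mean (fun z => c * u z) = c * mean u.
Proof.
by move=> bu; rewrite /mean cintegralZ 1?mulrCA//; exact: bmcircle_integrable.
Qed.

Lemma meanJ u : bmcircle u -> mean (fun z => (u z)^*%C) = (mean u)^*%C.
Proof.
move=> bu; rewrite /mean cintegralJ ?conjcM ?conjc_real//.
exact: bmcircle_integrable.
Qed.

Lemma normc_mean_le u (M : R) : bmcircle u ->
  (forall t, normc (u (expi t)) <= M) -> normc (mean u) <= 2 * M.
Proof.
move=> bu uM; have pi0 : 0 < 2 * pi :> R by rewrite mulr_gt0// pi_gt0.
rewrite /mean Normc.normcM normcR ger0_norm; last by rewrite invr_ge0 ltW.
rewrite ler_pdivrMl//.
apply: (le_trans (normc_cintegral_le mD lebesgue_period_lty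
  (bmcircle_measurable bu) (fun t _ => uM t))).
rewrite [X in fine X]lebesgue_measure_period /=.
by have -> : 2 * pi * (2 * M) = 2 * (M * (2 * pi)) by ring.
Qed.

Lemma mean1 : mean (fun=> 1) = 1.
Proof.
have pi0 : 2 * pi != 0 :> R by rewrite gt_eqF// mulr_gt0// pi_gt0.
rewrite /mean /cintegral /= !Rintegral_cst//.
rewrite [X in fine X]lebesgue_measure_period /=.
by apply: eqcP; rewrite ?ReM ?ImM /= ?mul1r ?mul0r ?mulr0 ?subr0 ?addr0 ?mulVf.
Qed.

Lemma mean_cst c : mean (fun=> c) = c.
Proof.
rewrite -[RHS]mulr1 -mean1 -meanZ; last exact: bmcircle_cst.
by apply: eq_mean => t; rewrite mulr1.
Qed.

(** De Moivre's formula. *)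
Lemma expiX (t : R) k : expi t ^+ k = expi (k%:R * t).
Proof.
elim: k => [|k IH]; first by rewrite expr0 mul0r /expi cos0 sin0.
rewrite exprS IH -natr1 mulrDl mul1r addrC /expi cosD sinD.
by apply: eqcP; rewrite ?ReM ?ImM /=; ring.
Qed.

Lemma Rintegral_period_FTC (f F : R -> R) :
  (forall x : R, is_derive x 1 F (f x)) -> continuous f ->
  Rintegral leb D f = F pi - F (- pi).
Proof.
move=> dF cf; have cF x : {for x, continuous F}.
  by apply: differentiable_continuous; apply/derivable1_diffP; case: (dF x).
rewrite /Rintegral (@continuous_FTC2 _ f F)//.
- by rewrite gtrN// pi_gt0.
- exact: continuous_subspaceT.
- split=> [x _||]; first by case: (dF x).
    by apply: cvg_at_right_filter; exact: cF.
  by apply: cvg_at_left_filter; exact: cF.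
- by move=> x _; rewrite derive1E derive_val.
Qed.

Lemma continuous_scaled (g : R -> R) (c : R) :
  continuous g -> continuous (fun t => g (c * t)).
Proof.
move=> cg x; apply: (@continuous_comp _ _ _ ( *%R c) g); last exact: cg.
exact: mulrl_continuous.
Qed.

Lemma sin_natpi k : sin (k%:R * pi) = 0 :> R.
Proof.
elim: k => [|k IH]; first by rewrite mul0r sin0.
by rewrite -natr1 mulrDl mul1r sinDpi IH oppr0.
Qed.

Lemma Rintegral_cos_eq0 k : Rintegral leb D (fun t => cos (k.+1%:R * t)) = 0.
Proof.
have dF (x : R) : is_derive x 1 (fun t => k.+1%:R^-1 * sin (k.+1%:R * t))
    (cos (k.+1%:R * x)).
  apply: is_derive_eq; rewrite /GRing.scale/= !mulr1 mulrC -mulrA.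
  by rewrite mulfV ?pnatr_eq0// mulr1.
rewrite (Rintegral_period_FTC dF).
  by rewrite mulrN sinN sin_natpi oppr0 !mulr0 subr0.
exact/continuous_scaled/continuous_cos.
Qed.

Lemma Rintegral_sin_eq0 k : Rintegral leb D (fun t => sin (k.+1%:R * t)) = 0.
Proof.
have dF (x : R) : is_derive x 1 (fun t => - (k.+1%:R^-1 * cos (k.+1%:R * t)))
    (sin (k.+1%:R * x)).
  apply: is_derive_eq; rewrite /GRing.scale/= !mulr1 mulNr mulrN opprK.
  by rewrite mulrC -mulrA mulfV ?pnatr_eq0// mulr1.
rewrite (Rintegral_period_FTC dF); first by rewrite mulrN cosN subrr.
exact/continuous_scaled/continuous_sin.
Qed.

Lemma mean_Xn k : mean (fun z => z ^+ k.+1) = 0.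
Proof.
rewrite /mean /cintegral.
under eq_Rintegral do rewrite expiX /=.
under [X in _ +i* X]eq_Rintegral do rewrite expiX /=.
by rewrite Rintegral_cos_eq0 Rintegral_sin_eq0 mulr0.
Qed.

End Circle.

(** * Orthonormality of the Takenaka-Malmquist functions *)

Section Hardy.
Variable R : realType.
Implicit Types (u v G : R[i] -> R[i]) (a c : R[i]).

#[local] Hint Resolve normc_expi_le1 : core.

Lemma expi_mulJ (t : R) : expi t * (expi t)^*%C = 1.
Proof. by rewrite mulcJ normc_expi expr1n. Qed.

(** The algebra H^oo of the circle: a bounded function all of whose Fourier
coefficients of negative index vanish. This real-variable description replaces
holomorphy on the disc, so that Cauchy's formula is not called upon. *)
Definition Hinf G :=
  bmcircle G /\ forall k, mean (fun z => z ^+ k.+1 * G z) = 0.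

Lemma eq_Hinf G G' : G =1 G' -> Hinf G -> Hinf G'.
Proof. by move=> /funext ->. Qed.

Lemma bmcircle_XnM k G : bmcircle G -> bmcircle (fun z => z ^+ k * G z).
Proof.
move=> bG; apply: bmcircleM => //.
by apply: (@bmcircleX R id); exact: bmcircle_id.
Qed.

Lemma Hinf_cst c : Hinf (fun=> c).
Proof.
split=> [|k]; first exact: bmcircle_cst.
under eq_fun do rewrite mulrC.
rewrite meanZ ?mean_Xn ?mulr0//.
by apply: (@bmcircleX R id); exact: bmcircle_id.
Qed.

Lemma Hinf_sub a G : Hinf G -> Hinf (fun z => (z - a) * G z).
Proof.
move=> [bG G0]; split=> [|k]; first exact/bmcircleM/bG/bmcircle_sub.
rewrite (@eq_mean _ _ (fun z => z ^+ k.+2 * G z + - a * (z ^+ k.+1 * G z))).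
  rewrite meanD ?meanZ ?G0 ?mulr0 ?addr0//; [exact: bmcircle_XnM..|].
  by apply: bmcircleM; [exact: bmcircle_cst|exact: bmcircle_XnM].
by move=> t; rewrite (exprS _ k.+1); ring.
Qed.

(** With H = G / (1 - conj(a) z), the moments m_k of z^k H satisfy m_k =
conj(a) m_(k+1) for k >= 1, because z^k G = z^k H - conj(a) z^(k+1) H has mean
0. Iterating, |m_k| <= |a|^n sup |m_j|, which tends to 0 with n, so every m_k
vanishes. This is how boundary values of functions with poles outside the
closed disc are seen to have no negative frequencies. *)
Lemma Hinf_szego a G : unit_disc a -> Hinf G ->
  Hinf (fun z => (1 - a^*%C * z)^-1 * G z).
Proof.
move=> a1 [bG G0].
set H := fun z => _.
have bH : bmcircle H by apply: bmcircleM => //; exact: bmcircle_szego.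
split=> // k0.
pose m k := mean (fun z => z ^+ k * H z).
have mS k : m k.+1 = a^*%C * m k.+2.
  rewrite /m -meanZ; last exact: bmcircle_XnM.
  apply/eqP; rewrite -subr_eq0 -mulN1r -meanZ; last first.
    by apply: bmcircleM; [exact: bmcircle_cst|exact: bmcircle_XnM].
  rewrite -meanD; last 2 first.
  - exact: bmcircle_XnM.
  - apply: bmcircleM; first exact: bmcircle_cst.
    by apply: bmcircleM; [exact: bmcircle_cst|exact: bmcircle_XnM].
  rewrite -[X in _ == X](G0 k); apply/eqP/eq_mean => t.
  rewrite /H (exprS _ k.+1).
  by field; exact: szego_denom_neq0.
have [M HM] := bH.2.
have mle k : normc (m k) <= 2 * M.
  apply: normc_mean_le; first exact: bmcircle_XnM.
  by move=> t; rewrite Normc.normcM normcX normc_expi expr1n mul1r.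
have miter k n : m k.+1 = a^*%C ^+ n * m (n + k.+1)%N.
  elim: n => [|n IH]; first by rewrite mul1r.
  by rewrite IH addnS mS exprSr addSn addnS mulrA.
have bound n : normc (m k0.+1) <= normc a ^+ n * (2 * M).
  rewrite (miter _ n) Normc.normcM normcX normcJ2 ler_wpM2l//.
  by rewrite exprn_ge0// normc_ge0.
have cv : (fun n => normc a ^+ n * (2 * M)) @ \oo --> (0 : R).
  rewrite -[X in _ --> X](mul0r (2 * M)); apply: cvgMl.
  by apply: cvg_expr; rewrite ger0_norm// normc_ge0.
apply/eqP; rewrite -normc_eq0 eq_le normc_ge0 andbT -/(m k0.+1).
rewrite -(cvg_lim _ cv)//; apply: limr_ge; first exact: cvgP cv.
by near=> n; exact: bound.
Unshelve. all: by end_near. Qed.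

Lemma Hinf_blaschke (b : nat -> R[i]) (s : seq nat) G :
  {in s, forall l, unit_disc (b l)} -> Hinf G ->
  Hinf (fun z => \prod_(l <- s) ((z - b l) / (1 - (b l)^*%C * z)) * G z).
Proof.
move=> bs HG; elim: s bs => [|l s IH] bs.
  by apply: eq_Hinf HG => z; rewrite big_nil mul1r.
apply: (@eq_Hinf (fun z => (1 - (b l)^*%C * z)^-1 * ((z - b l) *
    (\prod_(l <- s) ((z - b l) / (1 - (b l)^*%C * z)) * G z)))).
  by move=> z; rewrite big_cons; ring.
apply: Hinf_szego; first by apply: bs; rewrite mem_head.
by apply/Hinf_sub/IH => j js; apply: bs; rewrite inE js orbT.
Qed.

Lemma normcsqrt_disc (c : R[i]) : unit_disc c ->
  (Num.sqrt (1 - normc c ^+ 2))%:C * (Num.sqrt (1 - normc c ^+ 2))%:C =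
  1 - c * c^*%C.
Proof.
move=> c1; rewrite mulcJ -real_complexM -expr2 sqr_sqrtr.
  by rewrite real_complexB.
by rewrite subr_ge0 expr_le1// ?normc_ge0// ltW.
Qed.

Section TakenakaMalmquist.
Variable a : nat -> R[i].
Hypothesis a_disc : forall k, (0 < k)%N -> unit_disc (a k).

Let phi l z := (z - a l) / (1 - (a l)^*%C * z).

Let s k : R[i] := (Num.sqrt (1 - normc (a k) ^+ 2))%:C.
Let q k z : R[i] := 1 - (a k)^*%C * z.

Let TME k z : TM a k z = s k / q k z * \prod_(1 <= l < k) phi l z.
Proof. by []. Qed.

Lemma Hinf_TM k : (0 < k)%N -> Hinf (TM a k).
Proof.
move=> k0.
apply: (@eq_Hinf (fun z => \prod_(1 <= l < k) phi l z *
    ((q k z)^-1 * s k))).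
  by move=> z; rewrite TME; ring.
apply: Hinf_blaschke => [l|].
  by rewrite mem_index_iota => /andP[l0 _]; exact: a_disc.
by apply: Hinf_szego; [exact: a_disc|exact: Hinf_cst].
Qed.

Lemma blaschke_unimodular l t : (0 < l)%N ->
  phi l (expi t) * (phi l (expi t))^*%C = 1.
Proof.
move=> l0; rewrite mulcJ.
suff -> : normc (phi l (expi t)) = 1 by rewrite expr1n.
rewrite Normc.normcM Normc.normcV.
have -> : normc (expi t - a l) = normc (1 - (a l)^*%C * expi t).
  rewrite -normcJ2 conjcB -[LHS]mul1r -(normc_expi t) -Normc.normcM mulrBr.
  by rewrite expi_mulJ mulrC.
by rewrite divff// normc_eq0 szego_denom_neq0//; exact: a_disc.
Qed.

Lemma blaschke_prod_unimodular m n t (p := \prod_(m <= l < n) phi l (expi t)) :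
  (0 < m)%N -> p * p^*%C = 1.
Proof.
move=> m0; rewrite (rmorph_prod (@conjc R)) -big_split /= big_nat big1// => j.
by move=> /andP[mj _]; apply: blaschke_unimodular; exact: leq_trans mj.
Qed.

(** On the circle every Blaschke factor is unimodular, so the first k - 1
factors cancel, and (z - a_k) / conj(1 - conj(a_k) z) = z. What remains is z
times an element of H^oo, whose mean is 0. *)
Lemma TM_orthogonal k l : (0 < k < l)%N ->
  mean (fun z => TM a l z * (TM a k z)^*%C) = 0.
Proof.
move=> /andP[k0 kl].
pose G z := (q k z)^-1 *
  (\prod_(k.+1 <= j < l) phi j z * ((q l z)^-1 * (s k * s l))).
have HG : Hinf G.
  apply: Hinf_szego; first exact: a_disc.
  apply: Hinf_blaschke => [j|].
    rewrite mem_index_iota => /andP[j0 _].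
    by apply: a_disc; apply: leq_ltn_trans j0.
  by apply: Hinf_szego; [apply: a_disc; exact: ltn_trans kl|exact: Hinf_cst].
rewrite -(HG.2 0%N); apply: eq_mean => t; set z := expi t.
rewrite !TME (big_cat_nat (n := k)) ?(ltnW kl)//= (big_ltn kl) !conjcM.
rewrite conjc_inv conjc_real expr1 /G {2}/phi -/(q k z).
set P := \prod_(1 <= _ < k) _; set Q := \prod_(k.+1 <= _ < l) _.
have PP : P * P^*%C = 1 by exact: blaschke_prod_unimodular.
have qJ : (z - a k) / (q k z)^*%C = z.
  have q0 : (q k z)^*%C != 0.
    rewrite conjc_eq0; apply: szego_denom_neq0; first exact: a_disc.
    exact: normc_expi_le1.
  apply: (mulIf q0); rewrite mulfVK// /q conjcB conjcM conjcK conjc1.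
  by rewrite mulrBr mulr1 mulrCA expi_mulJ mulr1.
transitivity (P * P^*%C * ((z - a k) / (q k z)^*%C) *
    ((q k z)^-1 * (Q * ((q l z)^-1 * (s k * s l))))); first by ring.
by rewrite PP qJ mul1r.
Qed.

(** The Blaschke factors cancel and leave the Poisson kernel, which equals p +
conj(p) - 1 on the circle for the Szegő kernel p at a_k; and p has mean 1. *)
Lemma TM_normalized k : (0 < k)%N ->
  mean (fun z => TM a k z * (TM a k z)^*%C) = 1.
Proof.
move=> k0; have ak := a_disc k0.
have bp : bmcircle (fun z => (q k z)^-1) by exact: bmcircle_szego.
have [_ zp0] : Hinf (fun z => (q k z)^-1).
  apply: (@eq_Hinf (fun z => (q k z)^-1 * 1)); first by move=> z; rewrite mulr1.
  by apply: Hinf_szego => //; exact: Hinf_cst.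
have meanp : mean (fun z => (q k z)^-1) = 1.
  transitivity (mean (fun z => 1 + (a k)^*%C * (z ^+ 1 * (q k z)^-1))).
    apply: eq_mean => t; rewrite expr1 /q; field; exact: szego_denom_neq0.
  rewrite meanD; [|exact: bmcircle_cst|].
    by rewrite mean_cst meanZ ?zp0 ?mulr0 ?addr0//; exact: bmcircle_XnM.
  by apply: bmcircleM; [exact: bmcircle_cst|exact: bmcircle_XnM].
transitivity (mean (fun z => (q k z)^-1 + ((q k z)^-1)^*%C + -1)).
  apply: eq_mean => t; set z := expi t.
  rewrite !TME; set P := \prod_(1 <= _ < k) _.
  have PP : P * P^*%C = 1 by exact: blaschke_prod_unimodular.
  have ss : s k * s k = 1 - a k * (a k)^*%C := normcsqrt_disc ak.
  have q0 : q k z != 0 by exact: szego_denom_neq0 (normc_expi_le1 t).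
  have qJ0 : (q k z)^*%C != 0 by rewrite conjc_eq0.
  rewrite !conjcM !conjc_inv conjc_real.
  transitivity (P * P^*%C * (s k * s k) / q k z / (q k z)^*%C); first by ring.
  rewrite PP ss mul1r.
  have -> : 1 - a k * (a k)^*%C = q k z + (q k z)^*%C - q k z * (q k z)^*%C.
    rewrite /q conjcB conjcM conjcK conjc1.
    transitivity (1 - (a k)^*%C * a k * (z * z^*%C)); last by ring.
    by rewrite expi_mulJ; ring.
  by field; apply/andP.
have bpJ := bmcircleJ bp.
rewrite meanD ?meanD ?meanJ ?meanp//; [|exact: bmcircleD|exact: bmcircle_cst].
by rewrite mean_cst conjc1; ring.
Qed.

End TakenakaMalmquist.

End Hardy.

(** * Tensor products and the Christoffel-Darboux formula *)

Section Tensor.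
Variable R : realType.
Implicit Types (u v : R[i] -> R[i]) (a b : nat -> R[i]).

Local Notation leb := (@lebesgue_measure R).
Local Notation D := (`[- pi, pi]%classic : set (measurableTypeR R)).
Local Notation mu := (@lebesgue2 R).
Local Notation sq := (@square R).

Let mD : measurable D. Proof. exact: measurable_itv. Qed.

Definition bm (p : measurableTypeR R -> R) :=
  measurable_fun setT p /\ exists M : R, forall t, `|p t| <= M.

Lemma bm_integrable p : bm p -> leb.-integrable D (EFin \o p).
Proof.
move=> [mp [M pM]]; apply: measurable_bounded_integrable => //.
- exact: lebesgue_period_lty.
- exact: measurable_funTS.
- exists M; split; first by rewrite num_real.
  by move=> y My x _; apply: le_trans (ltW My).
Qed.

Lemma bm_prod_integrable p q : bm p -> bm q ->
  mu.-integrable sq (fun x => (p x.1 * q x.2)%:E).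
Proof.
move=> [mp [M pM]] [mq [N qN]].
apply: (@measurable_bounded_integrable _ _ _ mu (fun x => p x.1 * q x.2)).
- exact: measurable_square.
- exact: lebesgue2_square_lty.
- apply: measurable_funTS; apply: measurable_funM.
    exact: (measurableT_comp mp measurable_fst).
  exact: (measurableT_comp mq measurable_snd).
- exists (M * N); split; first by rewrite num_real.
  move=> y My x _; apply: le_trans (ltW My).
  by rewrite normrM ler_pM.
Qed.

(** Fubini's theorem for a product of functions of one variable. *)
Lemma Rintegral_square_prod (p q : measurableTypeR R -> R) : bm p -> bm q ->
  Rintegral mu sq (fun x => p x.1 * q x.2) =
  Rintegral leb D p * Rintegral leb D q.
Proof.
move=> bp bq.
have ip := bm_integrable bp; have iq := bm_integrable bq.
have ipq := bm_prod_integrable bp bq.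
have iq' : leb.-integrable setT (EFin \o (q \_ D)).
  by rewrite -restrict_EFin; apply/integrable_restrict => //; rewrite setTI.
have ip' : leb.-integrable setT (EFin \o (p \_ D)).
  by rewrite -restrict_EFin; apply/integrable_restrict => //; rewrite setTI.
rewrite Rintegral_mkcond.
rewrite [X in _ = X * _]Rintegral_mkcond [X in _ = _ * X]Rintegral_mkcond.
pose F x : \bar R := ((p \_ D) x.1 * (q \_ D) x.2)%:E.
have FE : (EFin \o ((fun x => p x.1 * q x.2) \_ sq)) = F.
  apply/funext => x; rewrite /F /= !patchE /square in_setX.
  by case: (x.1 \in _); case: (x.2 \in _); rewrite /= ?mul0r ?mulr0.
have iF : mu.-integrable setT F.
  rewrite -FE -restrict_EFin; apply/integrable_restrict => //.
    exact: measurable_square.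
  by rewrite setTI.
have := integral12_prod_meas1 iF.
rewrite /fubini_F => EF.
rewrite /Rintegral.
rewrite -[X in integral _ _ X]/(EFin \o ((fun x => p x.1 * q x.2) \_ sq)).
have FI : (\int[leb]_x \int[leb]_y F (x, y) =
    \int[leb]_x (((p \_ D) x)%:E * \int[leb]_y ((q \_ D) y)%:E))%E.
  by apply: eq_integral => x _; rewrite -integralZl//; exact: iq'.
have fq := integrable_fin_num measurableT iq'.
have fp := integrable_fin_num measurableT ip'.
by rewrite FE -EF FI -(fineK fq) integralZr// fineM.
Qed.

Lemma bmcircle_Re u : bmcircle u -> bm (fun t => Re (u (expi t))).
Proof.
move=> [[m1 _] [M uM]]; split=> //; exists M => t.
exact: le_trans (Re_le_normc _) (uM t).
Qed.

Lemma bmcircle_Im u : bmcircle u -> bm (fun t => Im (u (expi t))).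
Proof.
move=> [[_ m1] [M uM]]; split=> //; exists M => t.
exact: le_trans (Im_le_normc _) (uM t).
Qed.

Lemma cintegral_square_prod u v : bmcircle u -> bmcircle v ->
  ((4 * pi ^+ 2)^-1)%:C * cintegral mu sq (fun x => u (expi x.1) * v (expi x.2))
  = mean u * mean v.
Proof.
move=> bu bv; rewrite /cintegral.
have [ru iu] := (bmcircle_Re bu, bmcircle_Im bu).
have [rv iv] := (bmcircle_Re bv, bmcircle_Im bv).
under eq_Rintegral do rewrite ReM.
under [X in _ +i* X]eq_Rintegral do rewrite ImM.
have msq := @measurable_square R.
rewrite RintegralB//; [|exact: bm_prod_integrable ru rv
  |exact: bm_prod_integrable iu iv].
rewrite RintegralD//; [|exact: bm_prod_integrable ru iv
  |exact: bm_prod_integrable iu rv].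
rewrite (Rintegral_square_prod ru rv) (Rintegral_square_prod iu iv).
rewrite (Rintegral_square_prod ru iv) (Rintegral_square_prod iu rv).
rewrite /mean mulrACA -real_complexM -invfM.
have -> : 2 * pi * (2 * pi) = 4 * pi ^+ 2 :> R by ring.
by congr (_ * _); apply: eqcP; rewrite ?ReM ?ImM.
Qed.

Lemma cmeasurable_tensor u v : bmcircle u -> bmcircle v ->
  cmeasurable sq (on_torus (tensor u v)).
Proof.
move=> [[u1 u2] _] [[v1 v2] _]; apply: cmeasurableM; split;
  apply: measurable_funTS.
- exact: (measurableT_comp u1 measurable_fst).
- exact: (measurableT_comp u2 measurable_fst).
- exact: (measurableT_comp v1 measurable_snd).
- exact: (measurableT_comp v2 measurable_snd).
Qed.

Lemma L2_tensor u v : bmcircle u -> bmcircle v -> L2 (tensor u v).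
Proof.
move=> bu bv; have [[M uM] [N vN]] := (bu.2, bv.2).
apply: (L2_bounded (M := M * N)); first exact: cmeasurable_tensor.
by move=> t s; rewrite /tensor Normc.normcM ler_pM ?normc_ge0.
Qed.

Lemma sqnorm_tensor_le u v (M N : R) : bmcircle u -> bmcircle v ->
  (forall t, normc (u (expi t)) <= M) -> (forall t, normc (v (expi t)) <= N) ->
  (sqnorm (tensor u v) <= ((M * N) ^+ 2)%:E)%E.
Proof.
move=> bu bv uM vN; apply: sqnorm_bounded; first exact: cmeasurable_tensor.
by move=> t s; rewrite /tensor Normc.normcM ler_pM ?normc_ge0.
Qed.

Lemma inner_tensor u v u' v' :
  bmcircle u -> bmcircle v -> bmcircle u' -> bmcircle v' ->
  inner (tensor u v) (tensor u' v') =
  mean (fun z => u z * (u' z)^*%C) * mean (fun z => v z * (v' z)^*%C).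
Proof.
move=> bu bv bu' bv'.
rewrite -cintegral_square_prod; last 2 first.
- by apply: bmcircleM => //; exact: bmcircleJ.
- by apply: bmcircleM => //; exact: bmcircleJ.
congr (_ * _); apply: eq_cintegral => x _.
by rewrite /on_torus /tensor conjcM mulrACA.
Qed.

Lemma eq_inner f g h :
  (forall t s, f (expi t) (expi s) = g (expi t) (expi s)) ->
  inner (R := R) f h = inner g h.
Proof.
move=> fg; congr (_ * _); apply: eq_cintegral => x _.
by rewrite {1 3}/on_torus fg.
Qed.

Lemma eq_sqnorm f g :
  (forall t s, f (expi t) (expi s) = g (expi t) (expi s)) ->
  sqnorm (R := R) f = sqnorm g.
Proof.
move=> fg; congr (_ * _)%E; apply: eq_integral => x _.
by rewrite /on_torus fg.
Qed.

(** Fubini's theorem splits the inner product of two tensors into one-variable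
means. *)
Lemma TM_tensor_orthonormal a b k l k' l' :
  (forall k, (0 < k)%N -> unit_disc (a k)) ->
  (forall k, (0 < k)%N -> unit_disc (b k)) ->
  (0 < k)%N -> (0 < l)%N -> (0 < k')%N -> (0 < l')%N ->
  inner (tensor (TM a k) (TM b l)) (tensor (TM a k') (TM b l')) =
  ((k == k') && (l == l'))%:R.
Proof.
move=> ad bd k0 l0 k'0 l'0.
have orth (c : nat -> R[i]) i j : (forall k, (0 < k)%N -> unit_disc (c k)) ->
    (0 < i)%N -> (0 < j)%N ->
    mean (fun z => TM c i z * (TM c j z)^*%C) = (i == j)%:R.
  move=> cd i0 j0; have [ij|ji|->] := ltngtP i j.
  - have -> : (fun z => TM c i z * (TM c j z)^*%C) =
        (fun z => (TM c j z * (TM c i z)^*%C)^*%C).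
      by apply/funext => z; rewrite conjcM conjcK mulrC.
    rewrite meanJ ?TM_orthogonal ?i0 ?conjc0//.
    by apply: bmcircleM; [|apply: bmcircleJ]; apply: (Hinf_TM _ _).1.
  - by rewrite TM_orthogonal ?j0.
  - exact: TM_normalized.
rewrite inner_tensor; [|by apply: (Hinf_TM _ _).1..].
by rewrite !orth//; case: (k == k'); case: (l == l'); rewrite ?mulr1 ?mulr0.
Qed.

(** The inductive step of the Christoffel-Darboux formula, in which x' and y'
stand for the conjugates of x and y. *)
Lemma Christoffel_Darboux_step (F : fieldType) (x x' y' z : F) :
  1 - y' * z != 0 -> 1 - x' * z != 0 -> 1 - x * y' != 0 ->
  (1 - y' * z)^-1 = (1 - x * x') / (1 - x * y') / (1 - x' * z) +
    (y' - x') / (1 - x * y') * ((z - x) / (1 - x' * z)) / (1 - y' * z).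
Proof. by move=> h1 h2 h3; field; rewrite h1 h2 h3. Qed.

(** The Takenaka-Malmquist functions give the reproducing kernel of their span;
the remainder carries the Blaschke product of all the parameters. *)
Lemma Christoffel_Darboux_TM a alpha z n :
  (forall k, (0 < k)%N -> unit_disc (a k)) -> unit_disc alpha -> normc z <= 1 ->
  let phi y := \prod_(1 <= l < n.+1) ((y - a l) / (1 - (a l)^*%C * y)) in
  (1 - alpha^*%C * z)^-1 =
    \sum_(1 <= k < n.+1) (TM a k alpha)^*%C * TM a k z +
    (phi alpha)^*%C * phi z / (1 - alpha^*%C * z).
Proof.
move=> ad al1 z1 /=; have alz := szego_denom_neq0 al1 z1.
elim: n => [|n IH]; first by rewrite !big_geq// conjc1 add0r !mul1r.
rewrite {1}IH !(@big_nat_recr _ _ _ n.+1)//= -addrA; congr (_ + _).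
rewrite /TM; set p1 := \prod_(1 <= _ < n.+1) _.
set p2 := \prod_(1 <= _ < n.+1) _.
have an := ad n.+1 isT.
have qz := szego_denom_neq0 an z1.
have qal := szego_denom_neq0 an (ltW al1).
have qalJ : (1 - a n.+1 * alpha^*%C) != 0.
  by move: qal; rewrite -conjc_eq0 conjcB conjcM conjcK conjc1.
rewrite !conjcM !conjc_inv conjc_real !conjcB !conjcM !conjcK !conjc1.
set s := (Num.sqrt _)%:C.
have ss : s * s = 1 - a n.+1 * (a n.+1)^*%C := normcsqrt_disc an.
transitivity (p1^*%C * p2 *
    (s * s / (1 - a n.+1 * alpha^*%C) / (1 - (a n.+1)^*%C * z) +
     (alpha^*%C - (a n.+1)^*%C) / (1 - a n.+1 * alpha^*%C) *
       ((z - a n.+1) / (1 - (a n.+1)^*%C * z)) / (1 - alpha^*%C * z)));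
  last by ring.
by rewrite ss -Christoffel_Darboux_step.
Qed.

(** At alpha = a_n the Blaschke product in the remainder of the
Christoffel-Darboux formula vanishes. Hence choosing the parameter a_n puts the
Szegő kernel at a_n in the span of the first n functions. *)
Lemma szego_in_span_TM a n z : (forall k, (0 < k)%N -> unit_disc (a k)) ->
  (0 < n)%N -> normc z <= 1 ->
  (1 - (a n)^*%C * z)^-1 =
    \sum_(1 <= k < n.+1) (TM a k (a n))^*%C * TM a k z.
Proof.
move=> ad n0 z1; rewrite (Christoffel_Darboux_TM n ad (ad n n0) z1).
rewrite [X in (X)^*%C * _ / _]big_nat_recr//= subrr mul0r mulr0 conjc0 !mul0r.
by rewrite addr0.
Qed.

End Tensor.

(** * Orthogonal projections for a positive form on a subspace *)

(** A positive sesquilinear form that behaves well only on a subspace W of V.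
Square-integrable functions on the torus are represented by arbitrary total
functions, among which they form such a subspace; the form may be degenerate.
*)
Record sesquilinear_on (R : realType) (V : lmodType R[i]) (W : V -> Prop)
    (ip : V -> V -> R[i]) : Prop := SesquilinearOn {
  so_0 : W 0;
  so_D : forall f g, W f -> W g -> W (f + g);
  so_Z : forall c f, W f -> W (c *: f);
  so_ipD : forall f g h, W f -> W g -> W h -> ip (f + g) h = ip f h + ip g h;
  so_ipZ : forall c f h, W f -> W h -> ip (c *: f) h = c * ip f h;
  so_ipJ : forall f g, W f -> W g -> ip f g = (ip g f)^*%C;
  so_ip_ge0 : forall f, W f -> 0 <= ip f f }.

Definition norm2 (R : realType) (V : Type) (ip : V -> V -> R[i]) (f : V) : R :=
  Re (ip f f).

Section PreHilbert.
Variables (R : realType) (V : lmodType R[i]) (W : V -> Prop).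
Variable ip : V -> V -> R[i].
Hypothesis H : sesquilinear_on W ip.

Local Notation W0 := (so_0 H).
Local Notation WD := (so_D H).
Local Notation WZ := (so_Z H).
Local Notation ipDl := (so_ipD H).
Local Notation ipZl := (so_ipZ H).
Local Notation ipJ := (so_ipJ H).
Local Notation ip_ge0 := (so_ip_ge0 H).
Local Notation sqn := (norm2 ip).

Lemma norm2_ge0 f : W f -> 0 <= sqn f.
Proof. by move=> /ip_ge0; rewrite lecE => /andP[]. Qed.

Lemma ip_self f : W f -> ip f f = (sqn f)%:C.
Proof. by move=> Wf; apply: eqcP => //=; apply/ger0_Im/ip_ge0. Qed.

Lemma WB f g : W f -> W g -> W (f - g).
Proof. by move=> Wf Wg; rewrite -scaleN1r; exact/WD/WZ. Qed.

Lemma W_sum (I : Type) (s : seq I) (c : I -> R[i]) (e : I -> V) :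
  (forall i, W (e i)) -> W (\sum_(i <- s) c i *: e i).
Proof.
by move=> We; elim/big_ind: _ => [||i _]; [exact: W0|exact: WD|exact: WZ].
Qed.

Lemma ipBl f g h : W f -> W g -> W h -> ip (f - g) h = ip f h - ip g h.
Proof.
by move=> Wf Wg Wh; rewrite -scaleN1r ipDl ?ipZl ?mulN1r//; exact: WZ.
Qed.

Lemma ipDr f g h : W f -> W g -> W h -> ip f (g + h) = ip f g + ip f h.
Proof.
move=> Wf Wg Wh; rewrite ipJ ?ipDl ?conjcD -?ipJ//; exact: WD.
Qed.

Lemma ipZr c f h : W f -> W h -> ip f (c *: h) = c^*%C * ip f h.
Proof. by move=> Wf Wh; rewrite ipJ ?ipZl ?conjcM -?ipJ//; exact: WZ. Qed.

Lemma ipBr f g h : W f -> W g -> W h -> ip f (g - h) = ip f g - ip f h.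
Proof.
move=> Wf Wg Wh; rewrite ipJ ?ipBl ?conjcB -?ipJ//; exact: WB.
Qed.

Lemma norm2B f g : W f -> W g ->
  sqn (f - g) = sqn f - 2 * Re (ip f g) + sqn g.
Proof.
move=> Wf Wg; rewrite /norm2 ipBl ?ipBr//; last exact: WB.
by rewrite (ipJ Wg Wf) !ReD !ReN !ReD !ReN ReJ; ring.
Qed.

(** Positivity of |f - t (f, g) g|^2 for every real t; the form being possibly
degenerate, the case |g| = 0 is treated separately. *)
Lemma Cauchy_Schwarz f g : W f -> W g ->
  normc (ip f g) ^+ 2 <= sqn f * sqn g.
Proof.
move=> Wf Wg; have [A AE] : exists A, A = normc (ip f g) ^+ 2 by eexists.
have AC : ip f g * (ip f g)^*%C = A%:C by rewrite mulcJ AE.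
rewrite -AE.
have quad (t : R) : 0 <= sqn f - 2 * t * A + t ^+ 2 * A * sqn g.
  have := norm2_ge0 (WB Wf (WZ (t%:C * ip f g) Wg)).
  rewrite norm2B ?ipZr//; [|exact: WZ].
  rewrite /norm2 ipZl ?ipZr//; [|exact: WZ].
  rewrite (ip_self Wg) conjcM conjc_real -mulrA [_^*%C * _]mulrC AC.
  have -> : t%:C * ip f g * (t%:C * (ip f g)^*%C * (sqn g)%:C) =
      (t ^+ 2 * A * sqn g)%:C.
    rewrite expr2 !real_complexM.
    by rewrite -AC; ring.
  by rewrite -real_complexM /= mulrA.
have [N0|Nneq] := eqVneq (sqn g) 0.
  (* This value of t makes the quadratic, affine when |g| = 0, equal to -1. *)
  rewrite N0 mulr0; have := quad ((sqn f + 1) / (2 * A)).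
  rewrite N0 mulr0 addr0.
  have [//|Aneq] := eqVneq A 0; first by move=> ->.
  have -> : 2 * ((sqn f + 1) / (2 * A)) * A = sqn f + 1 by field.
  by have := norm2_ge0 Wf; lra.
have Ngt : 0 < sqn g by rewrite lt_def Nneq norm2_ge0.
have := quad (sqn g)^-1.
have -> : sqn f - 2 / sqn g * A + (sqn g)^-1 ^+ 2 * A * sqn g =
    sqn f - A / sqn g by field.
by rewrite subr_ge0 ler_pdivrMr.
Qed.

Section Projection.
Variables (I : eqType) (e : I -> V).
Hypothesis We : forall i, W (e i).
Implicit Types (s : seq I) (c : I -> R[i]).

Definition orthonormal_on s :=
  {in s &, forall i j, ip (e i) (e j) = (i == j)%:R}.

Definition proj s f := \sum_(i <- s) ip f (e i) *: e i.

Lemma W_proj s f : W (proj s f). Proof. exact: W_sum. Qed.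

Lemma ip_suml s c h : W h ->
  ip (\sum_(i <- s) c i *: e i) h = \sum_(i <- s) c i * ip (e i) h.
Proof.
move=> Wh; elim: s => [|i s IH].
  by rewrite !big_nil -(scale0r (0 : V)) ipZl ?mul0r//; exact: W0.
by rewrite !big_cons ipDl ?ipZl ?IH//; [exact: WZ|exact: W_sum].
Qed.

Lemma ip_residual s f i : W f -> uniq s -> orthonormal_on s -> i \in s ->
  ip (f - proj s f) (e i) = 0.
Proof.
move=> Wf us os si; rewrite ipBl//; last exact: W_proj.
rewrite ip_suml// (bigD1_seq i)//= os// eqxx mulr1 big_seq_cond.
rewrite big1 ?addr0 ?subrr//.
by move=> j /andP[sj /negbTE ji]; rewrite os// ji mulr0.
Qed.

Lemma ip_residual_span s s' f c : W f -> uniq s' -> orthonormal_on s' ->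
  {subset s <= s'} -> ip (f - proj s' f) (\sum_(i <- s) c i *: e i) = 0.
Proof.
move=> Wf us os ss; have Wr := WB Wf (W_proj s' f).
rewrite ipJ ?ip_suml//; last exact: W_sum.
rewrite big_seq big1 ?conjc0// => i si.
by rewrite ipJ// ip_residual ?conjc0 ?mulr0//; exact: ss.
Qed.

Lemma norm2_residual s f : W f -> uniq s -> orthonormal_on s ->
  ip (f - proj s f) (f - proj s f) = ip (f - proj s f) f.
Proof.
move=> Wf us os; have Wr := WB Wf (W_proj s f).
rewrite [LHS]ipBr//; last exact: W_proj.
by rewrite ip_residual_span ?subr0.
Qed.

(** Pythagoras: proj s' f - proj s f lies in the span of s', to which the
residual of s' is orthogonal. *)
Lemma norm2_residual_decr s s' f : W f -> uniq s' -> orthonormal_on s' ->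
  {subset s <= s'} ->
  sqn (f - proj s f) = sqn (f - proj s' f) + sqn (proj s' f - proj s f).
Proof.
move=> Wf us os ss; have Wr := WB Wf (W_proj s' f).
have Wd := WB (W_proj s' f) (W_proj s f).
have -> : f - proj s f = (f - proj s' f) - (proj s f - proj s' f).
  by rewrite opprB addrA subrK.
have Wd' := WB (W_proj s f) (W_proj s' f).
rewrite norm2B// ipBr; [|exact: Wr|exact: W_proj..].
rewrite !ip_residual_span// subr0 mulr0 subr0; congr (_ + _).
rewrite !norm2B; [|exact: W_proj..].
by rewrite (ipJ (W_proj _ _) (W_proj _ _)) ReJ; ring.
Qed.

(** A vector g of the span of s' is orthogonal to the residual of s', so (f -
proj s f, g) = (proj s' f - proj s f, g), and Cauchy-Schwarz applies. This
turns control of the energy gained from s to s' into control of the residual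
tested against g. *)
Lemma residual_span_le s s' f c : W f -> uniq s' -> orthonormal_on s' ->
  normc (ip (f - proj s f) (\sum_(i <- s') c i *: e i)) ^+ 2 <=
  sqn (proj s' f - proj s f) * sqn (\sum_(i <- s') c i *: e i).
Proof.
move=> Wf us os; set g := \sum_(i <- s') _.
have Wg : W g by exact: W_sum.
have -> : f - proj s f = (f - proj s' f) + (proj s' f - proj s f).
  by rewrite addrA subrK.
rewrite ipDl//; [|by apply: WB => //; exact: W_proj..].
rewrite ip_residual_span// add0r.
by apply: Cauchy_Schwarz => //; apply: WB; exact: W_proj.
Qed.

Section IncreasingProjections.
Variables (f : V) (s : nat -> seq I).
Hypothesis Wf : W f.
Hypothesis us : forall n, uniq (s n).
Hypothesis os : forall n, orthonormal_on (s n).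
Hypothesis ss : forall n, {subset s n <= s n.+1}.

Local Notation P n := (proj (s n) f).

Let W_residual n : W (f - P n). Proof. exact: WB Wf (W_proj _ _). Qed.
Let W_increment n : W (P n.+1 - P n). Proof. by apply: WB; exact: W_proj. Qed.

Lemma norm2_residual_step n :
  sqn (f - P n) = sqn (f - P n.+1) + sqn (P n.+1 - P n).
Proof. by apply: norm2_residual_decr => //; exact: ss. Qed.

Lemma norm2_residual_le n : sqn (f - P n) <= sqn f.
Proof.
have ss0 : {subset [::] <= s n} by [].
have := norm2_residual_decr Wf (us n) (@os n) ss0.
rewrite [proj [::] f]big_nil !subr0 => ->; rewrite lerDl norm2_ge0//.
exact: W_proj.
Qed.

(** The squared norms of the residuals decrease and are bounded below, so their
successive differences, which are the squared increments, tend to 0. *)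
Lemma norm2_increment_cvg0 : (fun n => sqn (P n.+1 - P n)) @ \oo --> (0 : R).
Proof.
have cv : cvgn (fun n => sqn (f - P n)).
  apply: nonincreasing_is_cvgn.
    apply/nonincreasing_seqP => n.
    by rewrite (norm2_residual_step n) lerDl norm2_ge0.
  by exists 0 => _ [n _ <-]; exact: norm2_ge0.
have -> : (fun n => sqn (P n.+1 - P n)) =
    (fun n => sqn (f - P n) - sqn (f - P n.+1)).
  by apply/funext => n; rewrite (norm2_residual_step n) addrAC subrr add0r.
rewrite -[X in _ --> X](subrr (limn (fun n => sqn (f - P n)))).
by apply: cvgB => //; rewrite (cvg_shiftS (fun n => sqn (f - P n))).
Qed.

End IncreasingProjections.
End Projection.

Section WeakConvergence.
Variables (r : nat -> V) (B : R).
Hypothesis Wr : forall n, W (r n).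
Hypothesis rB : forall n, sqn (r n) <= B.

Definition weakly_null g :=
  W g /\ (fun n => normc (ip (r n) g)) @ \oo --> (0 : R).

Lemma weakly_nullP g : W g ->
  (forall eps : R, 0 < eps ->
     \forall n \near \oo, normc (ip (r n) g) <= eps) -> weakly_null g.
Proof.
move=> Wg Hg; split=> //; apply/cvgrPdist_le => eps e0.
apply: filterS (Hg _ e0) => n.
by rewrite sub0r normrN ger0_norm// normc_ge0.
Qed.

Lemma weakly_null_near g (eps : R) : weakly_null g -> 0 < eps ->
  \forall n \near \oo, normc (ip (r n) g) <= eps.
Proof.
move=> [Wg /cvgrPdist_le Hg] e0; apply: filterS (Hg _ e0) => n.
by rewrite sub0r normrN ger0_norm// normc_ge0.
Qed.

Lemma weakly_nullD g h : weakly_null g -> weakly_null h -> weakly_null (g + h).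
Proof.
move=> ng nh; have [[Wg _] [Wh _]] := (ng, nh).
apply: weakly_nullP => [|eps e0]; first exact: WD.
have e2 : 0 < eps / 2 by rewrite divr_gt0.
near=> n; rewrite ipDr// [leRHS]splitr.
apply: (le_trans (le_normcD _ _)); apply: lerD; near: n.
  exact: weakly_null_near.
exact: weakly_null_near.
Unshelve. all: by end_near. Qed.

Lemma weakly_nullZ c g : weakly_null g -> weakly_null (c *: g).
Proof.
move=> [Wg cg]; split; first exact: WZ.
have -> : (fun n => normc (ip (r n) (c *: g))) =
    (fun n => normc c * normc (ip (r n) g)).
  by apply/funext => n; rewrite ipZr// Normc.normcM normcJ2.
by rewrite -[X in _ --> X](mulr0 (normc c)); exact: cvgMr.
Qed.

Lemma weakly_null0 : weakly_null 0.
Proof.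
split; first exact: W0.
have -> : (fun n => normc (ip (r n) 0)) = fun=> 0.
  apply/funext => n; rewrite -(scale0r (0 : V)) ipZr ?conjc0 ?mul0r//.
    exact: Normc.normc0.
  exact: W0.
exact: cvg_cst.
Qed.

Lemma weakly_null_sum (I : Type) (s : seq I) (F : I -> V) :
  (forall i, weakly_null (F i)) -> weakly_null (\sum_(i <- s) F i).
Proof.
by move=> HF; elim/big_ind: _ => //; [exact: weakly_null0|exact: weakly_nullD].
Qed.

(** The bound on |r_n| makes weak nullity stable under limits in norm. *)
Lemma weakly_null_lim g : W g ->
  (forall eps : R, 0 < eps ->
     exists h, weakly_null h /\ sqn (g - h) <= eps ^+ 2) ->
  weakly_null g.
Proof.
move=> Wg Hg; apply: weakly_nullP => // eps e0.
have B0 : 0 <= B := le_trans (norm2_ge0 (Wr 0%N)) (rB 0%N).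
have B1 : 0 < B + 1 by rewrite ltr_wpDl.
have e2 : 0 < eps / 2 by rewrite divr_gt0.
have eta0 := divr_gt0 e2 B1; set eta := _ / _ in eta0.
have [h [nh gh]] := Hg _ eta0; have Wh := nh.1.
have Wgh := WB Wg Wh.
near=> n; rewrite -[g](subrK h) addrC ipDr// [leRHS]splitr.
apply: (le_trans (le_normcD _ _)); apply: lerD.
  by near: n; exact: weakly_null_near.
have -> : eps / 2 = (B + 1) * eta by rewrite [RHS]mulrC /eta divfK// gt_eqF.
have pos : 0 <= (B + 1) * eta by rewrite mulr_ge0// ltW.
rewrite -(@ler_pXn2r _ 2)// ?nnegrE ?normc_ge0// exprMn.
apply: (le_trans (Cauchy_Schwarz (Wr n) Wgh)).
apply: ler_pM => //; [exact: norm2_ge0|exact: norm2_ge0|].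
by apply: (le_trans (rB n)); rewrite expr2; nra.
Unshelve. all: by end_near. Qed.

End WeakConvergence.
End PreHilbert.

(** * Szegő kernels and powers of the variable *)

Section Powers.
Variable R : realType.
Variable P : (R[i] -> R[i]) -> Prop.
Hypothesis PD : forall u v, P u -> P v -> P (fun z => u z + v z).
Hypothesis PZ : forall c u, P u -> P (fun z => c * u z).
Hypothesis Plim : forall u, bmcircle u ->
  (forall eps : R, 0 < eps -> exists v, [/\ P v, bmcircle v &
     forall t, normc (u (expi t) - v (expi t)) <= eps]) -> P u.
Hypothesis Pszego : forall c, unit_disc c -> P (fun z => (1 - c^*%C * z)^-1).

Lemma unit_disc0 : unit_disc (0 : R[i]).
Proof. by rewrite /unit_disc /mkset Normc.normc0 ltr01. Qed.

Lemma P_eq_circle u v : bmcircle u -> bmcircle v ->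
  (forall t, u (expi t) = v (expi t)) -> P v -> P u.
Proof.
move=> bu bv uv Pv; apply: Plim => // eps e0; exists v; split=> // t.
by rewrite uv subrr Normc.normc0 ltW.
Qed.

(** By induction on k. For c <> 0, z^(k+1) / (1 - conj(c) z) is a difference
quotient: conj(c)^-1 (z^k / (1 - conj(c) z) - z^k). For c = 0, z^(k+1) is the
uniform limit of z^(k+1) / (1 - d z) as the real number d > 0 tends to 0. *)
Lemma szego_generates_Xn_szego k c : unit_disc c ->
  P (fun z => z ^+ k * (1 - c^*%C * z)^-1).
Proof.
have b j d : unit_disc d ->
    bmcircle (fun z : R[i] => z ^+ j * (1 - d^*%C * z)^-1).
  by move=> d1; apply: bmcircle_XnM; exact: bmcircle_szego.
elim: k c => [|k IH] c c1.
  by under eq_fun do rewrite expr0 mul1r; exact: Pszego.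
have nonzero d : unit_disc d -> d != 0 ->
    P (fun z => z ^+ k.+1 * (1 - d^*%C * z)^-1).
  move=> d1 d0; have dJ0 : d^*%C != 0 by rewrite conjc_eq0.
  pose v z := (d^*%C)^-1 * (z ^+ k * (1 - d^*%C * z)^-1 +
    -1 * (z ^+ k * (1 - 0^*%C * z)^-1)).
  have [b1 b0] := (b k d d1, b k 0 unit_disc0).
  apply: (@P_eq_circle _ v); first exact: b.
  - apply: bmcircleM; first exact: bmcircle_cst.
    by apply: bmcircleD => //; apply: bmcircleM => //; exact: bmcircle_cst.
  - move=> t; rewrite /v conjc0 mul0r subr0 invr1 mulr1 exprS.
    have := szego_denom_neq0 d1 (normc_expi_le1 t).
    by move=> dz; field; apply/andP.
  - apply: PZ; apply: PD; first exact: IH.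
    by apply: PZ; apply: IH; exact: unit_disc0.
have [->|] := eqVneq c 0; last exact: nonzero.
apply: Plim => [|eps e0]; first exact/b/unit_disc0.
(* On the circle the two functions differ by at most d / (1 - d), which is
   at most 2 d because d <= 1/2. *)
pose d := Num.min (2^-1) (eps / 2).
have d0 : 0 < d by rewrite lt_min invr_gt0 ltr0n divr_gt0.
have d12 : d <= 2^-1 by rewrite ge_min lexx.
have deps : d <= eps / 2 by rewrite ge_min lexx orbT.
have dd : unit_disc (d%:C : R[i]).
  rewrite /unit_disc /mkset normcR gtr0_norm//; lra.
exists (fun z => z ^+ k.+1 * (1 - (d%:C)^*%C * z)^-1); split.
- by apply: nonzero => //; rewrite -normc_eq0 normcR normr_eq0 gt_eqF.
- exact: b.
move=> t; set z := expi t.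
have dz := szego_denom_neq0 dd (normc_expi_le1 t).
have -> : z ^+ k.+1 * (1 - 0^*%C * z)^-1 - z ^+ k.+1 * (1 - (d%:C)^*%C * z)^-1 =
    - ((d%:C)^*%C * (z ^+ k.+2 * (1 - (d%:C)^*%C * z)^-1)).
  by rewrite conjc0 mul0r subr0 invr1 mulr1 (exprS _ k.+1); field.
rewrite normcN Normc.normcM [X in _ * X]Normc.normcM normcX normcJ2.
rewrite normc_expi expr1n mul1r Normc.normcV normcR.
rewrite gtr0_norm// ler_pdivrMr ?lt_def ?normc_ge0 ?normc_eq0 ?dz//.
have := szego_denom_ge d%:C (normc_expi_le1 t); rewrite normcR gtr0_norm//.
set N := normc _ => Nge.
have : eps * (1 - d) <= eps * N by rewrite ler_wpM2l// ltW.
suff : d <= eps * (1 - d) by lra.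
have : eps * d <= eps / 2 by rewrite ler_wpM2l// ltW.
lra.
Qed.

(** The class P is left abstract because it serves twice: it will be weak
nullity of tensor products, as a condition on the first factor and then on the
second. *)
Lemma szego_generates_Xn k : P (fun z => z ^+ k).
Proof.
have := szego_generates_Xn_szego k unit_disc0; congr P; apply/funext => z.
by rewrite conjc0 mul0r subr0 invr1 mulr1.
Qed.

End Powers.

Section MaximalSelection.
Variable R : realType.
Implicit Types (a b : nat -> R[i]).

Lemma TM_ext a a' k z : (forall j, (0 < j <= k)%N -> a j = a' j) -> (0 < k)%N ->
  TM a k z = TM a' k z.
Proof.
move=> aa k0; rewrite /TM aa ?k0//=; congr (_ * _).
apply: eq_big_nat => j /andP[j0 jk]; rewrite aa// j0 ltnW//.
Qed.

Lemma S_ext a b a' b' f n :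
  (forall j, (0 < j <= n)%N -> a j = a' j) ->
  (forall j, (0 < j <= n)%N -> b j = b' j) -> S_ a b f n = S_ a' b' f n.
Proof.
move=> aa bb; apply/funext => z; apply/funext => w; rewrite /S_.
apply: eq_big_nat => k /andP[k0 kn]; apply: eq_big_nat => l /andP[l0 ln].
have -> : tensor (TM a k) (TM b l) = tensor (TM a' k) (TM b' l) => //.
apply/funext => x; apply/funext => y; rewrite /tensor.
congr (_ * _); apply: TM_ext => // j /andP[j0 jk].
  by apply: aa; rewrite j0 (leq_trans jk).
by apply: bb; rewrite j0 (leq_trans jk).
Qed.

(** The scaling structure has to be the one of R[i] over itself, hence the
exponent o. *)
Definition torus_function : lmodType R[i] := (R[i] -> R[i] -> R[i]^o).
Local Notation V := torus_function.
Local Notation isL2 := (@L2 R : V -> Prop).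
Local Notation ip := (@inner R : V -> V -> R[i]).

Lemma L2_0 : isL2 0.
Proof.
apply: (L2_bounded (M := 0)); first exact: (cmeasurable_cst _ 0).
by move=> t s; rewrite Normc.normc0.
Qed.

Lemma L2_sesquilinear : sesquilinear_on isL2 ip.
Proof.
split; [exact: L2_0|exact: L2D|exact: L2Z|exact: innerD|exact: innerZ|
  exact: innerJ|exact: inner_ge0].
Qed.
Local Notation L2ip := L2_sesquilinear.

Local Notation sqn := (norm2 ip).

Lemma sqnormE f : L2 f -> sqnorm f = (sqn f)%:E.
Proof. by move=> /inner_self[E fin]; rewrite /norm2 E /= fineK. Qed.

Lemma torus_sumE (I : Type) (s : seq I) (F : I -> V) z w :
  (\sum_(i <- s) F i) z w = \sum_(i <- s) F i z w.
Proof. by elim: s => [|i s IH]; rewrite ?big_nil// !big_cons -IH. Qed.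

(** Indices start at 0 here, so that every pair of indices designates a
function with parameters in the disc; this shifts the numbering of the
parameters by one. *)
Definition TM_tensor a b (p : nat * nat) : V :=
  tensor (TM a p.1.+1) (TM b p.2.+1).
Definition pairs n := [seq (k, l) | k <- index_iota 0 n, l <- index_iota 0 n].

Lemma S_proj a b f n : S_ a b f n = proj ip (TM_tensor a b) (pairs n) f.
Proof.
apply/funext => z; apply/funext => w.
rewrite /S_ /proj torus_sumE big_allpairs big_add1 /=.
by apply: eq_bigr => k _; rewrite big_add1.
Qed.

Lemma uniq_pairs n : uniq (pairs n).
Proof. by apply: allpairs_uniq; rewrite ?iota_uniq// => -[? ?] [? ?]. Qed.

Lemma sub_pairs m n : (m <= n)%N -> {subset pairs m <= pairs n}.
Proof.
move=> mn _ /allpairsP[[k l] [/= ks ls ->]]; apply/allpairsP; exists (k, l).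
move: ks ls; rewrite !mem_index_iota /= => km lm.
by split=> //; apply: leq_trans mn.
Qed.

Section Fixed.
Variables a b : nat -> R[i].
Hypothesis ad : forall k, (0 < k)%N -> unit_disc (a k).
Hypothesis bd : forall k, (0 < k)%N -> unit_disc (b k).

Lemma L2_TM_tensor p : isL2 (TM_tensor a b p).
Proof. by apply: L2_tensor; apply: (Hinf_TM _ _).1. Qed.

Lemma orthonormal_TM_tensor s : orthonormal_on ip (TM_tensor a b) s.
Proof.
by move=> [k l] [k' l'] _ _; rewrite /TM_tensor TM_tensor_orthonormal//= !eqSS.
Qed.

Lemma L2_S f n : isL2 (S_ a b f n).
Proof. rewrite S_proj; exact: (W_proj L2ip L2_TM_tensor). Qed.

Definition szego2 c d : V :=
  tensor (fun z => (1 - c^*%C * z)^-1) (fun w => (1 - d^*%C * w)^-1).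

(** The product of the Szegő kernels at a_n and b_n lies in the span onto which
S_n projects, so that the residual of S_m tested against it is controlled by
the norm of S_n f - S_m f. This is used for m = n - 1, where the difference is
D_n f. *)
Lemma residual_szego_le f m n : (0 < n)%N -> isL2 f ->
  normc (ip (f - S_ a b f m) (szego2 (a n) (b n))) ^+ 2 <=
  sqn (S_ a b f n - S_ a b f m : V) * sqn (szego2 (a n) (b n)).
Proof.
move=> n0 Lf.
pose g : V := \sum_(p <- pairs n)
  ((TM a p.1.+1 (a n))^*%C * (TM b p.2.+1 (b n))^*%C) *: TM_tensor a b p.
have gE t s : g (expi t) (expi s) = szego2 (a n) (b n) (expi t) (expi s).
  rewrite /g torus_sumE big_allpairs /szego2 /tensor.
  rewrite !szego_in_span_TM ?normc_expi_le1// !big_add1 /= big_distrl.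
  apply: eq_bigr => k _; rewrite big_distrr; apply: eq_bigr => l _ /=.
  by rewrite mulrACA.
have Lg : isL2 g := W_sum L2ip _ _ L2_TM_tensor.
have Lk : isL2 (szego2 (a n) (b n)).
  by apply: L2_tensor; apply: bmcircle_szego; [exact: ad|exact: bd].
have Lr := WB L2ip Lf (L2_S f m).
have -> : ip (f - S_ a b f m) (szego2 (a n) (b n)) = ip (f - S_ a b f m) g.
  by rewrite (so_ipJ L2ip)// (so_ipJ L2ip Lr Lg) (eq_inner _ gE).
have -> : sqn (szego2 (a n) (b n)) = sqn g.
  by apply: EFin_inj; rewrite -!sqnormE//; exact/esym/eq_sqnorm.
rewrite !S_proj.
apply: (residual_span_le L2ip L2_TM_tensor) => //.
  exact: uniq_pairs.
exact: orthonormal_TM_tensor.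
Qed.

End Fixed.

(** * Weak convergence of the residuals *)

Lemma lee_sqnorm (g h : V) : isL2 g -> isL2 h ->
  (sqnorm g <= sqnorm h)%E -> sqn g <= sqn h.
Proof. by move=> Lg Lh; rewrite (sqnormE Lg) (sqnormE Lh) lee_fin. Qed.

Lemma sqn_tensor_le u v (M N : R) : bmcircle u -> bmcircle v ->
  (forall t, normc (u (expi t)) <= M) -> (forall t, normc (v (expi t)) <= N) ->
  sqn (tensor u v) <= (M * N) ^+ 2.
Proof.
move=> bu bv uM vN; rewrite -lee_fin -sqnormE; last exact: L2_tensor.
exact: sqnorm_tensor_le.
Qed.

Lemma tensorBl u u' v :
  (tensor u v : V) - tensor u' v = tensor (fun z => u z - u' z) v.
Proof. by apply/funext => z; apply/funext => w; rewrite /tensor mulrBl. Qed.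

Lemma tensorBr u v v' :
  (tensor u v : V) - tensor u v' = tensor u (fun z => v z - v' z).
Proof. by apply/funext => z; apply/funext => w; rewrite /tensor mulrBr. Qed.

Lemma tensorDl u u' v :
  tensor (fun z => u z + u' z) v = (tensor u v : V) + tensor u' v.
Proof. by apply/funext => z; apply/funext => w; rewrite /tensor mulrDl. Qed.

Lemma tensorDr u v v' :
  tensor u (fun z => v z + v' z) = (tensor u v : V) + tensor u v'.
Proof. by apply/funext => z; apply/funext => w; rewrite /tensor mulrDr. Qed.

Lemma tensorZl c u v : tensor (fun z => c * u z) v = c *: (tensor u v : V).
Proof. by apply/funext => z; apply/funext => w; rewrite /tensor -mulrA. Qed.

Lemma tensorZr c u v : tensor u (fun z => c * v z) = c *: (tensor u v : V).
Proof. by apply/funext => z; apply/funext => w; rewrite /tensor mulrCA. Qed.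

Lemma bmcircleB (u v : R[i] -> R[i]) : bmcircle u -> bmcircle v ->
  bmcircle (fun z => u z - v z).
Proof.
move=> bu bv; apply: bmcircleD => //.
by under eq_fun do rewrite -mulN1r; apply: bmcircleM => //; exact: bmcircle_cst.
Qed.

Section WeakClosure.
Variables (r : nat -> V) (B : R).
Hypothesis Lr : forall n, isL2 (r n).
Hypothesis rB : forall n, sqn (r n) <= B.
Local Notation wn := (weakly_null isL2 ip r).

Hypothesis wn_szego : forall c d, unit_disc c -> unit_disc d -> wn (szego2 c d).

(** The number M is meant to bound the factor of a tensor product that is kept
fixed while the other one is approximated. *)
Lemma weakly_null_tensor_lim (g : V) (M : R) : isL2 g -> 0 <= M ->
  (forall eps : R, 0 < eps -> exists h,
     wn h /\ sqn (g - h) <= (eps * M) ^+ 2) -> wn g.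
Proof.
move=> Lg M0 H; apply: (weakly_null_lim L2ip Lr rB) => // eps e0.
have M1 : 0 < M + 1 by rewrite ltr_wpDl.
have [h [wh gh]] := H _ (divr_gt0 e0 M1); exists h; split=> //.
have le0 : 0 <= eps / (M + 1) * M by rewrite mulr_ge0// divr_ge0 ?ltW.
have le1 : eps / (M + 1) * M <= eps.
  by rewrite mulrAC ler_pdivrMr// ler_wpM2l ?(ltW e0)// lerDl ler01.
by apply: (le_trans gh); rewrite lerXn2r ?nnegrE// (le_trans le0).
Qed.

Lemma weakly_null_Xn_szego k d : unit_disc d ->
  wn (tensor (fun z => z ^+ k) (fun w => (1 - d^*%C * w)^-1)).
Proof.
move=> d1; have bd := bmcircle_szego d1.
apply: (@szego_generates_Xn R
  (fun u => wn (tensor u (fun w => (1 - d^*%C * w)^-1)))).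
- by move=> u v wu wv; rewrite tensorDl; exact: (weakly_nullD L2ip Lr).
- by move=> c u wu; rewrite tensorZl; exact: (weakly_nullZ L2ip Lr).
- move=> u bu H; have [M dM] := bd.2.
  have M0 : 0 <= M := le_trans (normc_ge0 _) (dM 0).
  apply: (weakly_null_tensor_lim _ M0); first exact: L2_tensor.
  move=> eps e0; have [v [wv bv uv]] := H eps e0.
  eexists; split; first exact: wv.
  by rewrite tensorBl; apply: sqn_tensor_le => //; exact: bmcircleB.
- by move=> c c1; exact: wn_szego.
Qed.

Lemma weakly_null_monomial k l : wn (tensor (fun z => z ^+ k) (fun w => w ^+ l)).
Proof.
have bk : bmcircle (fun z : R[i] => z ^+ k).
  by apply: (@bmcircleX R id); exact: bmcircle_id.
apply: (@szego_generates_Xn R (fun v => wn (tensor (fun z => z ^+ k) v))).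
- by move=> u v wu wv; rewrite tensorDr; exact: (weakly_nullD L2ip Lr).
- by move=> c u wu; rewrite tensorZr; exact: (weakly_nullZ L2ip Lr).
- move=> u bu H; have [M kM] := bk.2.
  have M0 : 0 <= M := le_trans (normc_ge0 _) (kM 0).
  apply: (weakly_null_tensor_lim _ M0); first exact: L2_tensor.
  move=> eps e0; have [v [wv bv uv]] := H eps e0.
  eexists; split; first exact: wv.
  by rewrite tensorBr mulrC; apply: sqn_tensor_le => //; exact: bmcircleB.
- by move=> c c1; exact: weakly_null_Xn_szego.
Qed.

(** Weak nullity passes from the products of two Szegő kernels to monomials,
one variable at a time, then to polynomials, and then to their limits in the
mean. *)
Lemma weakly_null_H2 (f : V) : H2 f -> wn f.
Proof.
move=> [Lf [c cv]]; apply: (weakly_null_lim L2ip Lr rB) => // eps e0.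
pose g N : V := \sum_(0 <= k < N) \sum_(0 <= l < N)
  c k l *: (tensor (fun z => z ^+ k) (fun w => w ^+ l) : V).
have wg N : wn (g N).
  apply: (weakly_null_sum L2ip Lr) => k.
  apply: (weakly_null_sum L2ip Lr) => l.
  exact/(weakly_nullZ L2ip Lr)/weakly_null_monomial.
have gE N : (fun z w => f z w -
    \sum_(0 <= k < N) \sum_(0 <= l < N) c k l * (z ^+ k * w ^+ l)) = f - g N.
  apply/funext => z; apply/funext => w.
  transitivity (f z w - g N z w) => //; congr (_ - _).
  rewrite /g torus_sumE; apply: eq_bigr => k _.
  by rewrite torus_sumE; apply: eq_bigr.
have Lg N : isL2 (f - g N) := WB L2ip Lf (wg N).1.
have {}cv : (sqn (f - g N))%:E @[N --> \oo] --> 0%E.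
  suff <- : (fun N => sqnorm (f - g N)) = (fun N => (sqn (f - g N))%:E).
    by move: cv; under eq_fun do rewrite gE.
  by apply/funext => N; exact: sqnormE.
have /fine_cvgP[_ /cvgrPdist_le /(_ _ (exprn_gt0 2 e0)) [N _ HN]] := cv.
exists (g N); split; first exact: wg.
have := HN N (leqnn N); rewrite /= sub0r normrN ger0_norm//.
exact: (norm2_ge0 L2ip (Lg N)).
Qed.

End WeakClosure.

Section Convergence.
Variables (f : V) (a b : nat -> R[i]) (k0 : nat).
Hypothesis Hf : H2 f.
Hypothesis ad : forall k, (0 < k)%N -> unit_disc (a k).
Hypothesis bd : forall k, (0 < k)%N -> unit_disc (b k).
Hypothesis msp : forall n, (k0 <= n)%N -> max_selection a b f n.

Let Lf : isL2 f := Hf.1.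
Let S n : V := S_ a b f n.
Let r n : V := f - S n.

Let LB (g h : V) : isL2 g -> isL2 h -> isL2 (g - h) .
Proof. exact: (WB L2ip). Qed.
Let LS n : isL2 (S n). Proof. exact: (L2_S ad bd). Qed.
Let Lr n : isL2 (r n). Proof. exact: LB. Qed.
Let LdS n : isL2 (S n.+1 - S n). Proof. exact: LB. Qed.

Let os n : orthonormal_on ip (TM_tensor a b) (pairs n).
Proof. exact: orthonormal_TM_tensor. Qed.
Let ss n : {subset pairs n <= pairs n.+1}.
Proof. exact: sub_pairs. Qed.

Lemma increment_cvg0 : (fun n => sqn (S n.+1 - S n)) @ \oo --> (0 : R).
Proof.
rewrite /S; under eq_fun do rewrite !S_proj.
exact: (norm2_increment_cvg0 L2ip (L2_TM_tensor ad bd)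
  Lf uniq_pairs os ss).
Qed.

Lemma residual_le n : sqn (r n) <= sqn f.
Proof.
rewrite /r /S S_proj.
exact: (norm2_residual_le L2ip (L2_TM_tensor ad bd)
  Lf uniq_pairs os).
Qed.

(** Applied to the competing parameters (c, d) at rank n + 1, the estimate for
products of Szegő kernels involves the increment produced by (c, d), and the
Maximal Selection Principle bounds it by the actual increment. The sums of rank
n are unchanged by the competing choice. *)
Lemma selection_bound n c d : (k0 <= n.+1)%N -> unit_disc c -> unit_disc d ->
  normc (ip (r n) (szego2 c d)) ^+ 2 <=
  sqn (S n.+1 - S n) * sqn (szego2 c d).
Proof.
move=> kn c1 d1; have [_ _ /(_ c d c1 d1) mx] := msp kn.
set a' := [eta a with n.+1 |-> c] in mx.
set b' := [eta b with n.+1 |-> d] in mx.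
have ad' k : (0 < k)%N -> unit_disc (a' k).
  by move=> k0'; rewrite /a' /=; case: ifP => // _; exact: ad.
have bd' k : (0 < k)%N -> unit_disc (b' k).
  by move=> k0'; rewrite /b' /=; case: ifP => // _; exact: bd.
have SE : S_ a' b' f n = S n.
  by apply: S_ext => j /andP[_ jn]; rewrite /a' /b' /= ltn_eqF.
have := residual_szego_le ad' bd' n (ltn0Sn n) Lf.
have -> : a' n.+1 = c by rewrite /a' /= eqxx.
have -> : b' n.+1 = d by rewrite /b' /= eqxx.
rewrite SE => /le_trans; apply; apply: ler_wpM2r.
  by apply: (norm2_ge0 L2ip); apply: L2_tensor; exact: bmcircle_szego.
have L1 : isL2 (S_ a' b' f n.+1 - S n : V).
  by apply: LB (LS n); exact: (L2_S ad' bd').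
apply: lee_sqnorm L1 (LdS n) _.
by move: mx; rewrite /D_ /= SE.
Qed.

Local Notation wn := (weakly_null isL2 ip r).

Lemma weakly_null_szego c d : unit_disc c -> unit_disc d -> wn (szego2 c d).
Proof.
move=> c1 d1; have Lk : isL2 (szego2 c d).
  by apply: L2_tensor; exact: bmcircle_szego.
apply: weakly_nullP => // eps e0.
have K1 : 0 < sqn (szego2 c d) + 1 by rewrite ltr_wpDl// (norm2_ge0 L2ip Lk).
have del0 := divr_gt0 (exprn_gt0 2 e0) K1.
have /cvgrPdist_le /(_ _ del0) := increment_cvg0.
apply: filterS2 (nbhs_infty_ge k0) => n kn.
rewrite sub0r normrN ger0_norm ?(norm2_ge0 L2ip (LdS n))// => dn.
rewrite -(@ler_pXn2r _ 2)// ?nnegrE ?normc_ge0 ?(ltW e0)//.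
apply: (le_trans (selection_bound (leqW kn) c1 d1)).
move: dn; rewrite ler_pdivlMr// => /(le_trans _); apply.
by rewrite ler_wpM2l ?(norm2_ge0 L2ip (LdS n))// lerDl ler01.
Qed.

(** The residual r_n is orthogonal to S_n f, so |r_n|^2 = (r_n, f), and f
itself is one of the functions against which r_n tends weakly to 0. *)
Lemma residual_cvg0 : sqnorm (r n) @[n --> \oo] --> 0%E.
Proof.
have [_ cv] := weakly_null_H2 Lr residual_le weakly_null_szego Hf.
under eq_fun do rewrite (sqnormE (Lr _)).
apply: cvg_EFin; first exact: nearW.
apply: (squeeze_cvgr _ (cvg_cst 0) cv); apply: nearW => n.
rewrite /= (norm2_ge0 L2ip (Lr n)) /=.
rewrite /norm2 /r /S S_proj.
rewrite (norm2_residual L2ip (L2_TM_tensor ad bd) Lf (uniq_pairs n) (@os n)).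
exact: le_trans (ler_norm _) (Re_le_normc _).
Qed.

End Convergence.

End MaximalSelection.

Theorem theorem2p4 (R : realType) (f : R[i] -> R[i] -> R[i]) (hf : H2 f)
  (k0 : nat) (hk0 : (1 <= k0)%N) (a b : nat -> R[i])
  (hfixed : forall k, (1 <= k < k0)%N -> unit_disc (a k) /\ unit_disc (b k))
  (hmsp : forall n, (k0 <= n)%N -> max_selection a b f n) :
  sqnorm (fun z w => f z w - S_ a b f n z w) @[n --> \oo] --> 0%E.
Proof.
have disc k : (0 < k)%N -> unit_disc (a k) /\ unit_disc (b k).
  move=> k_gt0; have [kk0|k0k] := ltnP k k0.
    by apply: hfixed; rewrite k_gt0.
  by have [] := hmsp k k0k.
exact: (residual_cvg0 hf (fun k k_gt0 => (disc k k_gt0).1)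
  (fun k k_gt0 => (disc k k_gt0).2) hmsp).
Qed.
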